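(* For any integers $s,M>0$, there exists a $0$-generic star graph with $s+1$ edges such that for every $L\leq M$ there exists a linear combination of the first $L$ eigenfunctions of $-\frac{\partial^2}{\partial x^2}$ on this graph having exactly $L-1+(L-1)(s-1)$ zeroes.
   Context: A star graph with $s+1$ edges is a metric graph with one central vertex joined to $s+1$ degree-one vertices by edges of finite lengths. The operator $-\frac{d^2}{dx^2}$ acts edgewise with Dirichlet conditions ($f=0$) at the degree-one vertices and Neumann–Kirchhoff conditions at the central vertex (continuity, and the sum over incident edges of outgoing derivatives equals zero). Its eigenvalues $\lambda_1\le\lambda_2\le\dots$ are counted with multiplicity, with $L^2$-orthogonal eigenfunctions $f_1,f_2,\dots$. The graph is $0$-generic if no eigenfunction of this operator vanishes at an inner (degree $\ge2$) vertex. Zeroes are counted on the graph excluding the degree-one (boundary) vertices. *)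

(* Defs.v *)
From Stdlib Require Import Reals List.
From Coquelicot Require Import Coquelicot.
Open Scope R_scope.

(* A star graph with s+1 edges, indexed j = 0..s, edge j of length len j.
   Edge j is parametrised by x in [0, len j], where x = 0 is the central
   vertex and x = len j is the degree-one (boundary) vertex of edge j.
   A function on the graph is given edgewise: f j : R -> R (only its values on
   [0, len j] for j <= s are relevant). *)
Definition graph_fun := nat -> R -> R.

(* f is an eigenfunction of -d^2/dx^2 with eigenvalue lam, with Dirichlet
   conditions at the degree-one vertices and Neumann-Kirchhoff conditions at
   the central vertex.  On each edge f j solves -f'' = lam f (as a smooth
   function of x, which is the unique extension of a solution on the edge). *)
Definition is_eigenfunction (s : nat) (len : nat -> R) (lam : R) (f : graph_fun) : Prop :=
  (forall j, (j <= s)%nat ->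
     exists f1 f2 : R -> R, forall x : R,
       is_derive (f j) x (f1 x) /\ is_derive f1 x (f2 x) /\ - f2 x = lam * f j x)
  /\ (forall j, (j <= s)%nat -> f j (len j) = 0)
  /\ (forall i j, (i <= s)%nat -> (j <= s)%nat -> f i 0 = f j 0)
  /\ sum_f_R0 (fun j => Derive (f j) 0) s = 0
  /\ (exists j x, (j <= s)%nat /\ 0 <= x <= len j /\ f j x <> 0).

Definition l2_inner (s : nat) (len : nat -> R) (f g : graph_fun) : R :=
  sum_f_R0 (fun j => RInt (fun x => f j x * g j x) 0 (len j)) s.

Definition zero_generic (s : nat) (len : nat -> R) : Prop :=
  forall lam f, is_eigenfunction s len lam f -> f 0%nat 0 <> 0.

(* (lam n, phi n)_{n >= 0} is the sequence of eigenvalues lam_1 <= lam_2 <= ...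
   counted with multiplicity (lam n is lambda_{n+1}), with L^2-orthogonal
   eigenfunctions phi n: every phi n is an eigenfunction for lam n, the phi n are
   pairwise orthogonal, lam is nondecreasing, and every eigenfunction of every
   eigenvalue mu is a finite linear combination of the phi n with lam n = mu
   (so each eigenvalue appears exactly as often as its multiplicity). *)
Definition spectral_sequence (s : nat) (len : nat -> R)
    (lam : nat -> R) (phi : nat -> graph_fun) : Prop :=
  (forall n, is_eigenfunction s len (lam n) (phi n))
  /\ (forall n, lam n <= lam (S n))
  /\ (forall m n, m <> n -> l2_inner s len (phi m) (phi n) = 0)
  /\ (forall mu g, is_eigenfunction s len mu g ->
        exists (N : nat) (c : nat -> R),
          (forall n, lam n <> mu -> c n = 0) /\
          (forall j x, (j <= s)%nat -> 0 <= x <= len j ->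
             g j x = sum_f_R0 (fun n => c n * phi n j x) N)).

(* Points of the graph excluding the degree-one vertices:
   None = the central vertex, Some (j, x) = interior point x in (0, len j) of edge j. *)
Definition is_zero_point (s : nat) (len : nat -> R) (g : graph_fun)
    (p : option (nat * R)) : Prop :=
  match p with
  | None => g 0%nat 0 = 0
  | Some (j, x) => (j <= s)%nat /\ 0 < x < len j /\ g j x = 0
  end.

Definition has_exactly_zeroes (s : nat) (len : nat -> R) (g : graph_fun) (K : nat) : Prop :=
  exists l : list (option (nat * R)),
    NoDup l /\ length l = K /\
    (forall p, In p l <-> is_zero_point s len g p).

(* Main.v *)
Require Import Defs.
From Stdlib Require Import Reals List.
From Coquelicot Require Import Coquelicot.
From Stdlib Require Import Lra Lia Psatz ClassicalEpsilon.
From Stdlib Require FinFun.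
Open Scope R_scope.

(* For incommensurable edge lengths [l j] the eigenvalues are the squares of the
   zeros [k] of [sum_j cot (k l j)], one between any two consecutive poles, and
   the eigenfunctions are [sin (k (l j - x)) / sin (k l j)].

   Take one edge of length 1 and [s] edges of nearly the same tiny length
   [epsilon].  On a short edge a combination of the first [L] eigenfunctions is
   a sum of [L] sines of the distance [y] to the leaf, which by Rolle's theorem
   has at most [L - 1] zeros.  For equal short edges there is a combination that
   vanishes to order [2 L - 1] at the short leaves.  As [epsilon -> 0] the
   frequencies tend to [n pi], and on the long edge this combination tends to
   [sin (pi x) (1 - cos (pi x))^(L-1)], which is positive; near the centre
   positivity follows from monotonicity.  A small change of the coefficients
   splits the multiple zero into [L - 1] sign changes on each short edge, and
   all these properties survive a small change of the lengths which makes them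
   incommensurable.  The total is [s (L - 1)] zeros. *)

(** * Finite sums and limits *)

(** The obstacle is exactness: no zero may appear on the long edge or at the centre. The limit
    function there vanishes to order 2L-1 at the centre, so convergence gives nothing nearby; an
    identity valid for each fixed epsilon, [equal_long_edge_split], fills this gap. Equal short
    edges are the starting point because a single function of the distance to the leaf then
    describes all of them, so L coefficients control s edges at once. A sum of sines is odd, which
    is why L coefficients achieve order 2L-1. Such a graph is not generic and has to be perturbed,
    so whatever is carried over must be an open condition: zeros are recorded as strict sign
    changes, and positivity comes with a positive derivative at the leaf. The long edge keeps length
    1 throughout, which pins the relevant poles at the multiples of pi. In the code [N] stands for
    L-1. *)

Lemma sum_f_R0_nonneg (f : nat -> R) (N : nat) :
  (forall j, (j <= N)%nat -> 0 <= f j) -> 0 <= sum_f_R0 f N.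
Proof.
  intros Hf. induction N as [|N IH]; simpl; [now apply Hf|].
  apply Rplus_le_le_0_compat; [apply IH; intros; apply Hf; lia|now apply Hf].
Qed.

Lemma sum_f_R0_ge_term (f : nat -> R) (N i : nat) :
  (forall j, (j <= N)%nat -> 0 <= f j) -> (i <= N)%nat -> f i <= sum_f_R0 f N.
Proof.
  induction N as [|N IH]; intros Hf Hi; simpl.
  - replace i with 0%nat by lia. lra.
  - destruct (Nat.eq_dec i (S N)) as [->|Hne].
    + assert (0 <= sum_f_R0 f N)
        by (apply sum_f_R0_nonneg; intros; apply Hf; lia).
      lra.
    + assert (f i <= sum_f_R0 f N) by (apply IH; [intros; apply Hf; lia|lia]).
      specialize (Hf (S N) (le_n _)). lra.
Qed.

Lemma sum_f_R0_zero (f : nat -> R) (N : nat) :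
  (forall j, (j <= N)%nat -> f j = 0) -> sum_f_R0 f N = 0.
Proof.
  intros Hf. induction N as [|N IH]; simpl; [now apply Hf|].
  rewrite IH, Hf; [lra|lia|intros; apply Hf; lia].
Qed.

Lemma sum_f_R0_single (f : nat -> R) (N i : nat) :
  (i <= N)%nat -> (forall j, (j <= N)%nat -> j <> i -> f j = 0) ->
  sum_f_R0 f N = f i.
Proof.
  induction N as [|N IH]; intros Hi Hf; simpl.
  - now replace i with 0%nat by lia.
  - destruct (Nat.eq_dec i (S N)) as [->|Hne].
    + rewrite sum_f_R0_zero; [lra|intros; apply Hf; lia].
    + rewrite IH, (Hf (S N)); [lra|lia|lia|lia|intros; apply Hf; lia].
Qed.

Lemma is_lim_seq_sum (u : nat -> nat -> R) (l : nat -> R) (N : nat) :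
  (forall n, (n <= N)%nat -> is_lim_seq (fun i => u i n) (l n)) ->
  is_lim_seq (fun i => sum_f_R0 (u i) N) (sum_f_R0 l N).
Proof.
  intros H. induction N as [|N IH]; simpl; [now apply H|].
  apply is_lim_seq_plus'; [apply IH; intros; apply H; lia|now apply H].
Qed.

Lemma is_derive_sum (f df : nat -> R -> R) (N : nat) (x : R) :
  (forall n, (n <= N)%nat -> is_derive (f n) x (df n x)) ->
  is_derive (fun x => sum_f_R0 (fun n => f n x) N) x
    (sum_f_R0 (fun n => df n x) N).
Proof.
  intros H. induction N as [|N IH]; simpl; [now apply H|].
  apply (is_derive_plus (fun x => sum_f_R0 (fun n => f n x) N) (f (S N)));
    [apply IH; intros; apply H; lia|now apply H].
Qed.

Lemma eventually_lt_lim (u : nat -> R) (l b : R) :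
  is_lim_seq u l -> b < l -> eventually (fun i => b < u i).
Proof.
  intros Hu Hb. apply is_lim_seq_spec in Hu.
  assert (He : 0 < l - b) by lra.
  destruct (Hu (mkposreal _ He)) as [n Hn]. exists n. intros i Hi.
  specialize (Hn i Hi). simpl in Hn. apply Rabs_def2 in Hn. lra.
Qed.

(** Yields one graph that serves all L up to [M], and all short edges, simultaneously. *)
Lemma eventually_bounded_forall (P : nat -> nat -> Prop) (N : nat) :
  (forall n, (n < N)%nat -> eventually (P n)) ->
  eventually (fun i => forall n, (n < N)%nat -> P n i).
Proof.
  induction N as [|N IH]; intros H.
  - exists 0%nat. intros; lia.
  - assert (H1 : eventually (fun i => forall n, (n < N)%nat -> P n i))
      by (apply IH; intros; apply H; lia).
    generalize (filter_and _ _ H1 (H N (Nat.lt_succ_diag_r N))).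
    apply filter_imp. intros i [Ha Hb] n Hn.
    destruct (Nat.eq_dec n N) as [->|]; [exact Hb|apply Ha; lia].
Qed.

Lemma is_lim_seq_inv_nat (m : nat) : is_lim_seq (fun i => / INR (i + S m)) 0.
Proof.
  apply (is_lim_seq_incr_n (fun i => / INR i) (S m)) .
  apply (is_lim_seq_inv _ p_infty); [apply is_lim_seq_INR|easy].
Qed.

Lemma mvt (f df : R -> R) (a b : R) :
  a < b -> (forall x, a <= x <= b -> is_derive f x (df x)) ->
  exists c, a < c < b /\ f b - f a = df c * (b - a).
Proof.
  intros Hab H.
  destruct (MVT_cor2 f df a b Hab) as [c [Hc Hi]].
  - intros x Hx. now apply is_derive_Reals, H.
  - now exists c.
Qed.

(** * Chains of zeros and of alternating signs *)

(** Increasing points encoded by a moving left endpoint, so that Rolle's theorem and the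
    intermediate value theorem apply by induction on [n]. *)
Fixpoint zero_chain (f : R -> R) (a b : R) (n : nat) : Prop :=
  match n with
  | O => True
  | S m => exists x, a < x < b /\ f x = 0 /\ zero_chain f x b m
  end.

Fixpoint sign_chain (f : R -> R) (sg a b : R) (n : nat) : Prop :=
  match n with
  | O => True
  | S m => exists x, a < x < b /\ 0 < sg * f x /\ sign_chain f (- sg) x b m
  end.

Lemma zero_chain_left (f : R -> R) (a a' b : R) (n : nat) :
  a' <= a -> zero_chain f a b n -> zero_chain f a' b n.
Proof.
  destruct n as [|n]; [easy|]. intros Ha [x [Hx H]]. exists x. split; [lra|easy].
Qed.

Lemma zero_chain_impl (f g : R -> R) (b : R) (n : nat) :
  forall a, (forall x, a < x < b -> f x = 0 -> g x = 0) ->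
  zero_chain f a b n -> zero_chain g a b n.
Proof.
  induction n as [|n IH]; [easy|]. intros a H [x [Hx [H0 Hc]]].
  exists x. repeat split; try easy; [now apply H|].
  apply IH; [|easy]. intros; apply H; [lra|easy].
Qed.

(** The zero at the endpoint [a] makes up for the one that Rolle's theorem loses. *)
Lemma zero_chain_rolle (f df : R -> R) (b : R) (n : nat) :
  forall a, f a = 0 -> (forall x, a <= x < b -> is_derive f x (df x)) ->
  zero_chain f a b n -> zero_chain df a b n.
Proof.
  induction n as [|n IH]; [easy|]. intros a Ha Hd [x [Hx [H0 Hc]]].
  destruct (mvt f df a x) as [c [Hc1 Hc2]]; [lra|intros; apply Hd; lra|].
  exists c. split; [lra|]. split.
  - rewrite H0, Ha in Hc2. nra.
  - apply zero_chain_left with x; [lra|].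
    apply IH; [easy|intros; apply Hd; lra|easy].
Qed.

Lemma zero_chain_of_signs (f : R -> R) (b : R) (n : nat) :
  (forall x, continuity_pt f x) ->
  forall sg a, sign_chain f sg a b (S n) -> zero_chain f a b n.
Proof.
  intros Hcont. induction n as [|n IH]; [easy|].
  intros sg a [x [Hx [Hs [y [Hy [Hs' Hr]]]]]].
  destruct (IVT (fun t => (- sg) * f t) x y) as [z [Hz Hz0]].
  - intros t. apply continuity_pt_mult; [apply continuity_pt_const; easy|apply Hcont].
  - lra.
  - lra.
  - lra.
  - assert (Hsg : sg <> 0) by (intros ->; lra).
    assert (Hfz : f z = 0) by nra.
    assert (z <> x) by (intros ->; lra). assert (z <> y) by (intros ->; lra).
    exists z. repeat split; try easy; try lra.
    apply (IH (- sg)). exists y. repeat split; try easy; lra.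
Qed.

(** Makes room to the left of the first point, where [sign_pattern] inserts a new one. *)
Lemma sign_chain_shrink (f : R -> R) (sg a b : R) (n : nat) :
  sign_chain f sg a b n -> exists a', a < a' /\ forall c, c < a' -> sign_chain f sg c b n.
Proof.
  destruct n as [|n]; simpl; intros H.
  - exists (a + 1). split; [lra|easy].
  - destruct H as [x [Hx H]]. exists x. split; [lra|].
    intros c Hc. exists x. split; [lra|easy].
Qed.

Lemma sign_chain_weaken (f : R -> R) (b b' : R) (n : nat) :
  b <= b' -> forall sg a, sign_chain f sg a b n -> sign_chain f sg a b' n.
Proof.
  intros Hb. induction n as [|n IH]; [easy|]. intros sg a [x [Hx [Hs H]]].
  exists x. split; [lra|]. split; [easy|now apply IH].
Qed.

Lemma sign_chain_stable (fi : nat -> R -> R) (f : R -> R) (b : R) (n : nat) :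
  (forall x, is_lim_seq (fun i => fi i x) (f x)) ->
  forall sg a, sign_chain f sg a b n ->
  eventually (fun i => sign_chain (fi i) sg a b n).
Proof.
  intros Hl. induction n as [|n IH]; intros sg a H.
  - now exists 0%nat.
  - destruct H as [x [Hx [Hs H]]].
    assert (H1 : eventually (fun i => 0 < sg * fi i x)).
    { apply eventually_lt_lim with (sg * f x); [|easy].
      apply (is_lim_seq_scal_l _ sg (f x)), Hl. }
    generalize (filter_and _ _ H1 (IH _ _ H)). apply filter_imp.
    intros i [Ha Hb]. now exists x.
Qed.

(* Inserting a further zero into a maximal chain would lengthen it. *)
Lemma zero_chain_exhausts (f : R -> R) (b : R) (n : nat) :
  forall a, zero_chain f a b n -> ~ zero_chain f a b (S n) ->
  exists l, NoDup l /\ length l = n /\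
    forall x, In x l <-> a < x < b /\ f x = 0.
Proof.
  induction n as [|n IH]; intros a H Hn.
  - exists nil. split; [constructor|]. split; [easy|]. intros x. split; [easy|].
    intros [Hx H0]. apply Hn. now exists x.
  - destruct H as [x [Hx [H0 Hc]]].
    assert (Hlow : forall y, a < y < x -> f y <> 0).
    { intros y Hy Hy0. apply Hn. exists y. split; [lra|]. split; [easy|].
      exists x. split; [lra|easy]. }
    destruct (IH x Hc) as [l [Hnd [Hlen Hl]]].
    { intros Hc'. apply Hn. now exists x. }
    exists (x :: l). split; [|split].
    + constructor; [|easy]. intros Hin. apply Hl in Hin. lra.
    + simpl. now rewrite Hlen.
    + intros y. simpl. rewrite Hl. split.
      * intros [<-|[Hy Hy0]]; [easy|]. split; [lra|easy].
      * intros [Hy Hy0]. destruct (Rtotal_order x y) as [Hxy|[Hxy|Hxy]].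
        -- right. split; [lra|easy].
        -- now left.
        -- exfalso. apply (Hlow y); [lra|easy].
Qed.

(** * Sums of sines: number of zeros and stability of positivity *)

Definition sine_comb (a k : nat -> R) (N : nat) (y : R) : R :=
  sum_f_R0 (fun n => a n * sin (k n * y)) N.

Definition sine_comb' (a k : nat -> R) (N : nat) (y : R) : R :=
  sum_f_R0 (fun n => a n * k n * cos (k n * y)) N.

Lemma is_derive_sine_comb (a k : nat -> R) (N : nat) (y : R) :
  is_derive (sine_comb a k N) y (sine_comb' a k N y).
Proof.
  apply (is_derive_sum (fun n y => a n * sin (k n * y))
    (fun n y => a n * k n * cos (k n * y))).
  intros n _. auto_derive; [easy|ring].
Qed.

Lemma is_derive_sine_comb' (a k : nat -> R) (N : nat) (y : R) :
  is_derive (sine_comb' a k N) y (- sine_comb (fun n => (k n)^2 * a n) k N y).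
Proof.
  replace (- sine_comb (fun n => (k n)^2 * a n) k N y) with
    (-(1) * sine_comb (fun n => (k n)^2 * a n) k N y) by ring.
  unfold sine_comb. rewrite scal_sum.
  apply (is_derive_sum (fun n y => a n * k n * cos (k n * y))
    (fun n y => (k n)^2 * a n * sin (k n * y) * -(1))).
  intros n _. auto_derive; [easy|ring].
Qed.

Lemma continuity_sine_comb (a k : nat -> R) (N : nat) (y : R) :
  continuity_pt (sine_comb a k N) y.
Proof.
  apply continuity_pt_filterlim, (ex_derive_continuous (sine_comb a k N)).
  eexists. apply is_derive_sine_comb.
Qed.

Lemma continuity_sine_comb' (a k : nat -> R) (N : nat) (y : R) :
  continuity_pt (sine_comb' a k N) y.
Proof.
  apply continuity_pt_filterlim, (ex_derive_continuous (sine_comb' a k N)).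
  eexists. apply is_derive_sine_comb'.
Qed.

Lemma sine_comb_0 (a k : nat -> R) (N : nat) : sine_comb a k N 0 = 0.
Proof.
  apply sum_f_R0_zero. intros. rewrite Rmult_0_r, sin_0. ring.
Qed.

Lemma sine_comb_odd (a k : nat -> R) (N : nat) (y : R) :
  sine_comb a k N (- y) = - sine_comb a k N y.
Proof.
  replace (- sine_comb a k N y) with (-(1) * sine_comb a k N y) by ring.
  unfold sine_comb. rewrite scal_sum. apply sum_eq. intros n _.
  replace (k n * - y) with (- (k n * y)) by ring. rewrite sin_neg. ring.
Qed.

Lemma sine_comb_ext (a a' k k' : nat -> R) (N : nat) (y : R) :
  (forall n, (n <= N)%nat -> a n = a' n) ->
  (forall n, (n <= N)%nat -> k n = k' n) ->
  sine_comb a k N y = sine_comb a' k' N y.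
Proof.
  intros Ha Hk. apply sum_eq. intros n Hn. now rewrite Ha, Hk.
Qed.

Lemma sine_comb_lin (a a' k : nat -> R) (t : R) (N : nat) (y : R) :
  sine_comb (fun n => a n + t * a' n) k N y =
  sine_comb a k N y + t * sine_comb a' k N y.
Proof.
  unfold sine_comb. rewrite scal_sum, <- plus_sum. apply sum_eq. intros; ring.
Qed.

(* Rolle's theorem for [f / sin (K y)] and then for the Wronskian of [f] and
   [sin (K y)] trades the frequency [K] for one zero. *)
Lemma sine_comb_zeros (N : nat) :
  forall (a k : nat -> R) (b : R),
  (forall n, (n <= N)%nat -> 0 < k n /\ k n * b <= PI) ->
  (forall m n, (m < n)%nat -> (n <= N)%nat -> k m < k n) ->
  zero_chain (sine_comb a k N) 0 b (S N) ->
  forall n, (n <= N)%nat -> a n = 0.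
Proof.
  induction N as [|N IH]; intros a k b Hk Hinc Hz.
  - destruct Hz as [x [Hx [H0 _]]]. unfold sine_comb in H0. simpl in H0.
    destruct (Hk 0%nat (le_n _)) as [Hk0 Hkb].
    assert (0 < sin (k 0%nat * x)) by (apply sin_gt_0; nra).
    intros n Hn. replace n with 0%nat by lia. nra.
  - set (K := k (S N)).
    destruct (Hk (S N) (le_n _)) as [HK HKb]. fold K in HK, HKb.
    set (f := sine_comb a k (S N)) in *.
    set (df := sine_comb' a k (S N)).
    (* [g] is [f'' + K^2 f], in which the top frequency cancels; the Wronskian of [f] and
       [sin (K y)] has derivative [g y * sin (K * y)]. *)
    set (g := sine_comb (fun n => (K^2 - (k n)^2) * a n) k N).
    assert (Hpos : forall x, 0 < x < b -> 0 < sin (K * x))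
      by (intros; apply sin_gt_0; nra).
    assert (Hdf : forall x, is_derive f x (df x))
      by (intros; apply is_derive_sine_comb).
    assert (Hdg : forall x, is_derive df x (g x - K^2 * f x)).
    { intros x. replace (g x - K^2 * f x) with
        (- sine_comb (fun n => (k n)^2 * a n) k (S N) x);
        [apply is_derive_sine_comb'|].
      unfold g, f, sine_comb. rewrite scal_sum, (tech5 (fun n => a n * _ * _)).
      rewrite tech5.
      replace (sum_f_R0 (fun n => (K^2 - (k n)^2) * a n * sin (k n * x)) N) with
        (sum_f_R0 (fun n => a n * sin (k n * x) * K^2) N
         + -(1) * sum_f_R0 (fun n => (k n)^2 * a n * sin (k n * x)) N).
      - unfold K. ring.
      - rewrite scal_sum, <- plus_sum. apply sum_eq. intros; ring. }
    assert (Hg : zero_chain g 0 b (S N)).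
    { destruct Hz as [x1 [Hx1 [H1 Hz]]].
      (* The quotient is singular at 0, so the first zero [x1] is spent as the base point: this is
         the one zero lost. *)
      assert (Hq : zero_chain
        (fun y => (df y * sin (K * y) - f y * (K * cos (K * y))) / (sin (K * y))^2)
        x1 b (S N)).
      { apply zero_chain_rolle with (fun y => f y / sin (K * y)).
        - rewrite H1. unfold Rdiv. ring.
        - intros x Hx. specialize (Hpos x ltac:(lra)).
          evar_last.
          + apply is_derive_div; [apply Hdf| |lra].
            auto_derive; [easy|reflexivity].
          + simpl. field. lra.
        - apply zero_chain_impl with f; [|easy].
          intros x _ ->. unfold Rdiv. ring. }
      assert (Hw : zero_chain (fun y => df y * sin (K * y) - f y * (K * cos (K * y))) 0 b (S N)).
      { apply zero_chain_left with x1; [lra|].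
        revert Hq. apply zero_chain_impl. intros x Hx Hx0.
        specialize (Hpos x ltac:(lra)).
        apply Rmult_eq_reg_r with (/ (sin (K * x))^2).
        - rewrite Rmult_0_l. exact Hx0.
        - apply Rinv_neq_0_compat. nra. }
      (* The Wronskian vanishes at 0, so this second use of Rolle's theorem loses no zero. *)
      assert (Hw' : zero_chain (fun y => g y * sin (K * y)) 0 b (S N)).
      { revert Hw. apply zero_chain_rolle.
        - unfold f. rewrite sine_comb_0, Rmult_0_r, sin_0. ring.
        - intros x _. evar_last.
          + apply (is_derive_minus (fun y => df y * sin (K * y))
              (fun y => f y * (K * cos (K * y)))).
            * apply (is_derive_mult df (fun y => sin (K * y)));
                [apply Hdg|auto_derive; [easy|reflexivity]|intros; apply Rmult_comm].
            * apply (is_derive_mult f (fun y => K * cos (K * y)));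
                [apply Hdf|auto_derive; [easy|reflexivity]|intros; apply Rmult_comm].
          + unfold minus, plus, opp, mult; simpl. unfold mult; simpl. ring. }
      revert Hw'. apply zero_chain_impl. intros x Hx Hx0.
      specialize (Hpos x Hx). nra. }
    assert (Ha : forall n, (n <= N)%nat -> a n = 0).
    { intros n Hn.
      assert (H := IH _ k b ltac:(intros; apply Hk; lia)
        ltac:(intros; apply Hinc; lia) Hg n Hn).
      simpl in H. assert (Hlt : k n < K) by (apply Hinc; lia).
      destruct (Hk n ltac:(lia)) as [Hkn _].
      apply Rmult_integral in H. destruct H; [nra|easy]. }
    intros n Hn. destruct (Nat.eq_dec n (S N)) as [->|]; [|apply Ha; lia].
    destruct Hz as [x [Hx [H0 _]]]. unfold f, sine_comb in H0.
    rewrite tech5, sum_f_R0_zero in H0.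
    + specialize (Hpos x Hx). unfold K in Hpos. nra.
    + intros j Hj. rewrite Ha by easy. ring.
Qed.

(* The condition on the derivative at [0] is what makes positivity on the
   half-open interval an open condition on [a] and [k], see [pos_comb_stable]. *)
Definition pos_comb (a k : nat -> R) (N : nat) (c : R) : Prop :=
  0 < sum_f_R0 (fun n => a n * k n) N /\
  forall z, 0 < z <= c -> 0 < sine_comb a k N z.

Lemma sine_comb'_0 (a k : nat -> R) (N : nat) :
  sine_comb' a k N 0 = sum_f_R0 (fun n => a n * k n) N.
Proof.
  apply sum_eq. intros. rewrite Rmult_0_r, cos_0. ring.
Qed.

(** Near 0 the slope comes from the derivative at 0, farther away from a minimum over a compact
    interval. A linear minorant is the right form because the error under perturbation is also
    linear in [z]. *)
Lemma pos_comb_lower (a k : nat -> R) (N : nat) (c : R) :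
  0 < c -> pos_comb a k N c ->
  exists m, 0 < m /\ forall z, 0 <= z <= c -> m * z <= sine_comb a k N z.
Proof.
  intros Hc [HD Hpos]. rewrite <- sine_comb'_0 in HD.
  set (D := sine_comb' a k N 0) in *.
  destruct (continuity_sine_comb' a k N 0 (D / 2)) as [eta [Heta Hcl]]; [lra|].
  set (e := Rmin (eta / 2) c).
  assert (He : 0 < e) by (apply Rmin_pos; lra).
  assert (He1 : e <= eta / 2) by apply Rmin_l.
  assert (He2 : e <= c) by apply Rmin_r.
  destruct (continuity_ab_min (sine_comb a k N) e c He2) as [mx [Hmx Hmx']].
  { intros. apply continuity_sine_comb. }
  assert (Hm0 := Hpos mx ltac:(lra)). set (m0 := sine_comb a k N mx) in *.
  exists (Rmin (D / 2) (m0 / c)). split.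
  { apply Rmin_pos; [lra|]. now apply Rdiv_lt_0_compat. }
  intros z Hz.
  destruct (Req_dec z 0) as [->|Hz0]; [rewrite sine_comb_0; lra|].
  destruct (Rle_dec z e) as [Hze|Hze].
  - destruct (mvt (sine_comb a k N) (sine_comb' a k N) 0 z) as [x [Hx Hxe]];
      [lra|intros; apply is_derive_sine_comb|].
    rewrite sine_comb_0 in Hxe.
    assert (Hdx : Rabs (sine_comb' a k N x - D) < D / 2).
    { apply Hcl. split; [split; [easy|lra]|]. simpl. unfold Rdist.
      rewrite Rabs_right; lra. }
    apply Rabs_def2 in Hdx.
    replace (sine_comb a k N z) with (sine_comb' a k N x * z) by lra.
    apply Rmult_le_compat_r; [lra|].
    apply Rle_trans with (D / 2); [apply Rmin_l|lra].
  - apply Rle_trans with m0; [|apply Hmx; lra].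
    apply Rle_trans with (m0 / c * z).
    + apply Rmult_le_compat_r; [lra|apply Rmin_r].
    + apply Rle_trans with (m0 / c * c).
      * apply Rmult_le_compat_l; [|lra]. now apply Rlt_le, Rdiv_lt_0_compat.
      * right. field. lra.
Qed.

Lemma sin_lipschitz (x y : R) : Rabs (sin x - sin y) <= Rabs (x - y).
Proof.
  destruct (Req_dec x y) as [->|Hxy]; [rewrite !Rminus_diag; lra|].
  assert (H : forall u v, u < v -> Rabs (sin v - sin u) <= Rabs (v - u)).
  { intros u v Huv. destruct (mvt sin cos u v Huv) as [c [_ Hc]].
    - intros. apply is_derive_sin.
    - rewrite Hc, Rabs_mult.
      assert (Rabs (cos c) <= 1) by (apply Rabs_le, COS_bound).
      assert (0 <= Rabs (v - u)) by apply Rabs_pos. nra. }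
  destruct (Rlt_dec x y) as [Hlt|Hlt].
  - rewrite Rabs_minus_sym, (Rabs_minus_sym x). now apply H.
  - apply H. lra.
Qed.

Lemma is_lim_seq_Rabs_diff (u : nat -> R) (l : R) :
  is_lim_seq u l -> is_lim_seq (fun i => Rabs (u i - l)) 0.
Proof.
  intros H. apply (is_lim_seq_abs_0 (fun i => u i - l)).
  replace 0 with (l - l) by ring. apply is_lim_seq_minus'; [easy|apply is_lim_seq_const].
Qed.

Lemma is_lim_seq_opp' (u : nat -> R) (l : R) :
  is_lim_seq u l -> is_lim_seq (fun i => - u i) (- l).
Proof.
  intros H. now apply (is_lim_seq_opp u l).
Qed.

(** Since sine is 1-Lipschitz, the perturbed sum differs from the limit by at most
    [sum_f_R0 (e i) N * z], whose slope tends to 0 and so drops below that of the linear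
    minorant. *)
Lemma pos_comb_stable (ai ki : nat -> nat -> R) (a k : nat -> R) (N : nat) (c : R) :
  0 < c ->
  (forall n, (n <= N)%nat -> is_lim_seq (fun i => ai i n) (a n)) ->
  (forall n, (n <= N)%nat -> is_lim_seq (fun i => ki i n) (k n)) ->
  pos_comb a k N c ->
  eventually (fun i => pos_comb (ai i) (ki i) N c).
Proof.
  intros Hc Ha Hk Hp.
  destruct (pos_comb_lower a k N c Hc Hp) as [m [Hm Hlow]].
  set (e := fun i n => Rabs (ai i n - a n) * Rabs (ki i n) + Rabs (a n) * Rabs (ki i n - k n)).
  assert (He : is_lim_seq (fun i => - sum_f_R0 (e i) N) 0).
  { replace 0 with (- sum_f_R0 (fun n => 0 * Rabs (k n) + Rabs (a n) * 0) N)
      by (rewrite sum_f_R0_zero; intros; ring).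
    apply is_lim_seq_opp', is_lim_seq_sum. intros n Hn.
    apply is_lim_seq_plus'; apply is_lim_seq_mult'.
    - now apply is_lim_seq_Rabs_diff, Ha.
    - now apply (is_lim_seq_abs _ (Finite (k n))), Hk.
    - apply is_lim_seq_const.
    - now apply is_lim_seq_Rabs_diff, Hk. }
  assert (H1 := eventually_lt_lim _ _ (- m) He ltac:(lra)).
  assert (Hs : is_lim_seq (fun i => sum_f_R0 (fun n => ai i n * ki i n) N)
                 (sum_f_R0 (fun n => a n * k n) N)).
  { apply is_lim_seq_sum. intros n Hn. apply is_lim_seq_mult'; [now apply Ha|now apply Hk]. }
  assert (H2 := eventually_lt_lim _ _ 0 Hs (proj1 Hp)).
  generalize (filter_and _ _ H1 H2). apply filter_imp.
  intros i [Hi1 Hi2]. split; [easy|]. intros z Hz.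
  assert (Hd : Rabs (sine_comb (ai i) (ki i) N z - sine_comb a k N z)
               <= sum_f_R0 (e i) N * z).
  { unfold sine_comb. rewrite <- minus_sum, (Rmult_comm _ z), scal_sum.
    apply Rle_trans with (1 := Rsum_abs _ _). apply sum_Rle. intros n _.
    unfold e.
    replace (ai i n * sin (ki i n * z) - a n * sin (k n * z)) with
      ((ai i n - a n) * (sin (ki i n * z) - sin 0) + a n * (sin (ki i n * z) - sin (k n * z)))
      by (rewrite sin_0; ring).
    apply Rle_trans with (1 := Rabs_triang _ _). rewrite !Rabs_mult.
    rewrite Rmult_plus_distr_r, !Rmult_assoc. apply Rplus_le_compat.
    - apply Rmult_le_compat_l; [apply Rabs_pos|].
      apply Rle_trans with (1 := sin_lipschitz _ _).
      rewrite Rminus_0_r, Rabs_mult, (Rabs_right z); lra.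
    - apply Rmult_le_compat_l; [apply Rabs_pos|].
      apply Rle_trans with (1 := sin_lipschitz _ _).
      rewrite <- Rmult_minus_distr_r, Rabs_mult, (Rabs_right z); lra. }
  apply Rabs_le_between in Hd. specialize (Hlow z ltac:(lra)).
  assert (sum_f_R0 (e i) N * z < m * z) by (apply Rmult_lt_compat_r; lra).
  lra.
Qed.

Lemma is_lim_seq_sine_comb (ai ki : nat -> nat -> R) (a k : nat -> R) (N : nat) (y : R) :
  (forall n, (n <= N)%nat -> is_lim_seq (fun i => ai i n) (a n)) ->
  (forall n, (n <= N)%nat -> is_lim_seq (fun i => ki i n) (k n)) ->
  is_lim_seq (fun i => sine_comb (ai i) (ki i) N y) (sine_comb a k N y).
Proof.
  intros Ha Hk. apply is_lim_seq_sum. intros n Hn.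
  apply is_lim_seq_mult'; [now apply Ha|].
  apply (is_lim_seq_continuous sin (fun i => ki i n * y)); [apply continuity_sin|].
  apply is_lim_seq_mult'; [now apply Hk|apply is_lim_seq_const].
Qed.

(** * The secular function *)

Definition cot_sum (s : nat) (l : nat -> R) (k : R) : R :=
  sum_f_R0 (fun j => cos (k * l j) / sin (k * l j)) s.

Definition pole_free (s : nat) (l : nat -> R) (p q : R) : Prop :=
  forall j k, (j <= s)%nat -> p < k < q -> sin (k * l j) <> 0.

Lemma cot_decr (l k k' : R) :
  0 < l -> k < k' -> (forall x, k <= x <= k' -> sin (x * l) <> 0) ->
  cos (k' * l) / sin (k' * l) < cos (k * l) / sin (k * l).
Proof.
  intros Hl Hk Hs.
  destruct (mvt (fun x => cos (x * l) / sin (x * l))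
    (fun x => - l / (sin (x * l))^2) k k' Hk) as [c [Hc He]].
  - intros x Hx. specialize (Hs x Hx).
    evar_last; [apply is_derive_div; [auto_derive; [easy|reflexivity]
      |auto_derive; [easy|reflexivity]|easy]|].
    simpl. replace (- l / (sin (x * l) * (sin (x * l) * 1))) with
      (- l * ((sin (x * l))² + (cos (x * l))²) / (sin (x * l) * (sin (x * l) * 1)))
      by (rewrite sin2_cos2; field; easy).
    unfold Rsqr. field. easy.
  - assert (Hs' : 0 < (sin (c * l))^2).
    { apply pow2_gt_0, Hs. lra. }
    assert (0 < l / (sin (c * l))^2 * (k' - k)).
    { apply Rmult_lt_0_compat; [|lra]. now apply Rdiv_lt_0_compat. }
    unfold Rdiv in *. nra.
Qed.

(** Every term decreases, so the whole sum falls at least as much as one term. This transfers the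
    blow-up of a single cotangent at its pole to the sum, without bounding the other terms. *)
Lemma cot_sum_decr_term (s : nat) (l : nat -> R) (p q k k' : R) (i : nat) :
  (forall j, (j <= s)%nat -> 0 < l j) -> pole_free s l p q ->
  p < k -> k < k' -> k' < q -> (i <= s)%nat ->
  cos (k * l i) / sin (k * l i) - cos (k' * l i) / sin (k' * l i)
  <= cot_sum s l k - cot_sum s l k'.
Proof.
  intros Hl Hpf Hk Hkk Hk' Hi. unfold cot_sum. rewrite <- minus_sum.
  apply (sum_f_R0_ge_term (fun j => cos (k * l j) / sin (k * l j)
    - cos (k' * l j) / sin (k' * l j))); [|easy].
  intros j Hj. apply Rlt_le, Rlt_0_minus, cot_decr; [now apply Hl|easy|].
  intros x Hx. apply Hpf; [easy|lra].
Qed.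

Lemma cot_sum_decr (s : nat) (l : nat -> R) (p q k k' : R) :
  (forall j, (j <= s)%nat -> 0 < l j) -> pole_free s l p q ->
  p < k -> k < k' -> k' < q -> cot_sum s l k' < cot_sum s l k.
Proof.
  intros Hl Hpf Hk Hkk Hk'.
  assert (H := cot_sum_decr_term s l p q k k' 0 Hl Hpf Hk Hkk Hk' (Nat.le_0_l _)).
  assert (cos (k' * l 0%nat) / sin (k' * l 0%nat) < cos (k * l 0%nat) / sin (k * l 0%nat)).
  { apply cot_decr; [apply Hl; lia|easy|]. intros x Hx. apply Hpf; [lia|lra]. }
  lra.
Qed.

Lemma cot_near_pole (l p B d : R) :
  0 < l -> sin (p * l) = 0 -> 0 < d ->
  exists h, 0 < h <= d /\ B < cos ((p + h) * l) / sin ((p + h) * l)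
                       /\ cos ((p - h) * l) / sin ((p - h) * l) < - B.
Proof.
  (* The witness is [h = x / l]: the first bound gives [h <= d], the second makes [cot x] at least
     [1 + Rabs B]. By pi-periodicity [cot x] is the value at [p + h], and its opposite the value at
     [p - h]. *)
  intros Hl Hp Hd. set (x := Rmin (d * l) (atan (/ (1 + Rabs B)))).
  assert (HB := Rabs_pos B). assert (HB' := Rle_abs B).
  assert (Hat : 0 < atan (/ (1 + Rabs B))).
  { rewrite <- atan_0. apply atan_increasing, Rinv_0_lt_compat. lra. }
  assert (Hat' := atan_bound (/ (1 + Rabs B))).
  assert (Hx0 : 0 < x) by (apply Rmin_pos; [nra|lra]).
  assert (Hx1 : x <= d * l) by apply Rmin_l.
  assert (Hx2 : x <= atan (/ (1 + Rabs B))) by apply Rmin_r.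
  assert (Hsx : 0 < sin x) by (apply sin_gt_0; lra).
  assert (Hcx : 0 < cos x) by (apply cos_gt_0; lra).
  assert (Hcot : B < cos x / sin x).
  { assert (Htan : tan x <= / (1 + Rabs B)).
    { rewrite <- (tan_atan (/ (1 + Rabs B))). destruct Hx2 as [Hx2| ->]; [|lra].
      left. apply tan_increasing; lra. }
    unfold tan in Htan. apply Rlt_le_trans with (1 + Rabs B); [lra|].
    apply Rmult_le_compat_r with (r := cos x / sin x * (1 + Rabs B)) in Htan.
    - replace (sin x / cos x * (cos x / sin x * (1 + Rabs B))) with (1 + Rabs B) in Htan
        by (field; lra).
      replace (/ (1 + Rabs B) * (cos x / sin x * (1 + Rabs B))) with (cos x / sin x) in Htan
        by (field; lra).
      easy.
    - apply Rmult_le_pos; [|lra]. apply Rlt_le, Rdiv_lt_0_compat; easy. }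
  assert (Hc : cos (p * l) <> 0).
  { intros H0. assert (H := sin2_cos2 (p * l)). rewrite Hp, H0 in H.
    unfold Rsqr in H. lra. }
  exists (x / l). split; [split|split].
  - now apply Rdiv_lt_0_compat.
  - apply Rmult_le_reg_r with l; [easy|]. unfold Rdiv. rewrite Rmult_assoc, Rinv_l; lra.
  - replace ((p + x / l) * l) with (p * l + x) by (field; lra).
    rewrite sin_plus, cos_plus, Hp.
    replace ((cos (p * l) * cos x - 0 * sin x) / (0 * cos x + cos (p * l) * sin x))
      with (cos x / sin x); [easy|field; lra].
  - replace ((p - x / l) * l) with (p * l - x) by (field; lra).
    rewrite sin_minus, cos_minus, Hp.
    replace ((cos (p * l) * cos x + 0 * sin x) / (0 * cos x - cos (p * l) * sin x))
      with (- (cos x / sin x)); [lra|field; lra].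
Qed.

Lemma continuous_cot_sum (s : nat) (l : nat -> R) (k : R) :
  (forall j, (j <= s)%nat -> sin (k * l j) <> 0) -> continuity_pt (cot_sum s l) k.
Proof.
  intros H. apply continuity_pt_filterlim, (ex_derive_continuous (cot_sum s l)).
  exists (sum_f_R0 (fun j => Derive (fun k => cos (k * l j) / sin (k * l j)) k) s).
  apply (is_derive_sum (fun j k => cos (k * l j) / sin (k * l j))
    (fun j k => Derive (fun k => cos (k * l j) / sin (k * l j)) k)).
  intros j Hj. apply Derive_correct. auto_derive. now apply H.
Qed.

Lemma cot_sum_root_exists (s : nat) (l : nat -> R) (p q : R) :
  (forall j, (j <= s)%nat -> 0 < l j) -> pole_free s l p q -> p < q ->
  (exists i, (i <= s)%nat /\ sin (p * l i) = 0) ->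
  (exists i, (i <= s)%nat /\ sin (q * l i) = 0) ->
  exists k, p < k < q /\ cot_sum s l k = 0.
Proof.
  intros Hl Hpf Hpq [i [Hi Hpi]] [j [Hj Hqj]].
  set (m := (p + q) / 2).
  assert (H1 : exists x, p < x < m /\ 0 < cot_sum s l x).
  (* The bound asked of the single cotangent is the one that forces the sum to be positive, by
     comparison with its value at the midpoint [m]; [(q - p) / 4] keeps [p + h] to the left of
     [m]. *)
  { destruct (cot_near_pole (l i) p
      (cos (m * l i) / sin (m * l i) - cot_sum s l m) ((q - p) / 4) (Hl i Hi) Hpi)
      as [h [Hh [Hh' _]]]; [lra|].
    exists (p + h). split; [unfold m; lra|].
    assert (H := cot_sum_decr_term s l p q (p + h) m i Hl Hpf
      ltac:(lra) ltac:(unfold m; lra) ltac:(unfold m; lra) Hi).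
    lra. }
  assert (H2 : exists x, m < x < q /\ cot_sum s l x < 0).
  { destruct (cot_near_pole (l j) q
      (- (cos (m * l j) / sin (m * l j)) + cot_sum s l m) ((q - p) / 4) (Hl j Hj) Hqj)
      as [h [Hh [_ Hh']]]; [lra|].
    exists (q - h). split; [unfold m; lra|].
    assert (H := cot_sum_decr_term s l p q m (q - h) j Hl Hpf
      ltac:(unfold m; lra) ltac:(unfold m; lra) ltac:(lra) Hj).
    lra. }
  destruct H1 as [x [Hx Hx0]]. destruct H2 as [y [Hy Hy0]].
  destruct (Ranalysis5.IVT_interv (fun t => - cot_sum s l t) x y) as [z [Hz Hz0]].
  - intros t Ht. apply continuity_pt_opp, continuous_cot_sum.
    intros; apply Hpf; [easy|lra].
  - lra.
  - lra.
  - lra.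
  - exists z. split; [lra|lra].
Qed.

Lemma cot_sum_root_unique (s : nat) (l : nat -> R) (p q k k' : R) :
  (forall j, (j <= s)%nat -> 0 < l j) -> pole_free s l p q ->
  p < k < q -> p < k' < q -> cot_sum s l k = 0 -> cot_sum s l k' = 0 -> k = k'.
Proof.
  intros Hl Hpf Hk Hk' H H'. destruct (Rtotal_order k k') as [Hlt|[He|Hlt]]; [|easy|].
  - assert (Hd := cot_sum_decr s l p q k k' Hl Hpf ltac:(lra) Hlt ltac:(lra)). lra.
  - assert (Hd := cot_sum_decr s l p q k' k Hl Hpf ltac:(lra) Hlt ltac:(lra)). lra.
Qed.

(** A total function of the two poles, so roots obtained from different enumerations of the poles
    are equal as soon as the poles are. *)
Definition cot_root (s : nat) (l : nat -> R) (p q : R) : R :=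
  epsilon (inhabits 0) (fun k => p < k < q /\ cot_sum s l k = 0).

Lemma cot_root_spec (s : nat) (l : nat -> R) (p q : R) :
  (forall j, (j <= s)%nat -> 0 < l j) -> pole_free s l p q -> p < q ->
  (exists i, (i <= s)%nat /\ sin (p * l i) = 0) ->
  (exists i, (i <= s)%nat /\ sin (q * l i) = 0) ->
  p < cot_root s l p q < q /\ cot_sum s l (cot_root s l p q) = 0.
Proof.
  intros.
  apply (epsilon_spec (inhabits 0) (fun k => p < k < q /\ cot_sum s l k = 0)).
  now apply cot_sum_root_exists.
Qed.

Lemma is_lim_seq_cot_sum (s : nat) (li : nat -> nat -> R) (l : nat -> R) (k : R) :
  (forall j, (j <= s)%nat -> is_lim_seq (fun i => li i j) (l j)) ->
  (forall j, (j <= s)%nat -> sin (k * l j) <> 0) ->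
  is_lim_seq (fun i => cot_sum s (li i) k) (cot_sum s l k).
Proof.
  intros Hl Hs. apply is_lim_seq_sum. intros j Hj.
  assert (Hkl : is_lim_seq (fun i => k * li i j) (k * l j)).
  { apply is_lim_seq_mult'; [apply is_lim_seq_const|now apply Hl]. }
  apply is_lim_seq_div'.
  - apply (is_lim_seq_continuous cos); [apply continuity_cos|easy].
  - apply (is_lim_seq_continuous sin); [apply continuity_sin|easy].
  - now apply Hs.
Qed.

(** Pointwise convergence at [k - e] and [k + e] is enough: the limit has strict opposite signs
    there, these persist, and monotonicity traps the perturbed root in between. *)
Lemma cot_root_continuous (s : nat) (li : nat -> nat -> R) (l : nat -> R) (p q : R)
    (ki : nat -> R) (k : R) :
  (forall i j, (j <= s)%nat -> 0 < li i j) -> (forall j, (j <= s)%nat -> 0 < l j) ->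
  (forall i, pole_free s (li i) p q) -> pole_free s l p q ->
  (forall j, (j <= s)%nat -> is_lim_seq (fun i => li i j) (l j)) ->
  (forall i, p < ki i < q /\ cot_sum s (li i) (ki i) = 0) ->
  p < k < q -> cot_sum s l k = 0 ->
  is_lim_seq ki k.
Proof.
  intros Hli Hl Hpi Hp Hlim Hki Hk Hk0.
  apply is_lim_seq_spec. intros [eps Heps]. simpl.
  set (e := Rmin eps (Rmin ((k - p) / 2) ((q - k) / 2))).
  assert (He : 0 < e) by (repeat apply Rmin_pos; lra).
  assert (He1 : e <= eps) by apply Rmin_l.
  assert (He2 : e <= (k - p) / 2)
    by (apply Rle_trans with (1 := Rmin_r _ _); apply Rmin_l).
  assert (He3 : e <= (q - k) / 2)
    by (apply Rle_trans with (1 := Rmin_r _ _); apply Rmin_r).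
  assert (Hd1 := cot_sum_decr s l p q (k - e) k Hl Hp ltac:(lra) ltac:(lra) ltac:(lra)).
  assert (Hd2 := cot_sum_decr s l p q k (k + e) Hl Hp ltac:(lra) ltac:(lra) ltac:(lra)).
  assert (H1 : eventually (fun i => 0 < cot_sum s (li i) (k - e))).
  { apply eventually_lt_lim with (cot_sum s l (k - e)); [|lra].
    apply is_lim_seq_cot_sum; [easy|]. intros; apply Hp; [easy|lra]. }
  assert (H2 : eventually (fun i => 0 < - cot_sum s (li i) (k + e))).
  { apply eventually_lt_lim with (- cot_sum s l (k + e)); [|lra].
    apply is_lim_seq_opp'.
    apply is_lim_seq_cot_sum; [easy|]. intros; apply Hp; [easy|lra]. }
  generalize (filter_and _ _ H1 H2). apply filter_imp. intros i [Ha Hb].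
  destruct (Hki i) as [Hi Hi0].
  assert (k - e < ki i).
  { destruct (Rlt_dec (k - e) (ki i)) as [|Hn]; [easy|exfalso].
    destruct (Req_dec (ki i) (k - e)) as [He'|He']; [rewrite He' in Hi0; lra|].
    assert (H := cot_sum_decr s (li i) p q (ki i) (k - e) (Hli i) (Hpi i)
      ltac:(lra) ltac:(lra) ltac:(lra)). lra. }
  assert (ki i < k + e).
  { destruct (Rlt_dec (ki i) (k + e)) as [|Hn]; [easy|exfalso].
    destruct (Req_dec (ki i) (k + e)) as [He'|He']; [rewrite He' in Hi0; lra|].
    assert (H' := cot_sum_decr s (li i) p q (k + e) (ki i) (Hli i) (Hpi i)
      ltac:(lra) ltac:(lra) ltac:(lra)). lra. }
  apply Rabs_def1; lra.
Qed.

(** * Sine combinations of maximal contact *)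

Lemma pos_increasing_from_0 (f df : R -> R) (b : R) :
  f 0 = 0 -> (forall y, is_derive f y (df y)) -> (forall y, 0 < y < b -> 0 < df y) ->
  forall y, 0 < y < b -> 0 < f y.
Proof.
  intros H0 Hd Hp y Hy.
  destruct (mvt f df 0 y) as [c [Hc He]]; [lra|intros; apply Hd|].
  specialize (Hp c ltac:(lra)). nra.
Qed.

(** Variation of constants for [u'' + K^2 u = P]: the combinations [u' sin - K u cos] and
    [u' cos + K u sin] have derivatives [P sin] and [P cos], positive on a quarter period, and [u']
    is recovered from them with coefficients sin and cos. *)
Lemma forced_oscillator_pos (u du P : R -> R) (K b : R) :
  0 < K -> K * b <= PI / 2 -> u 0 = 0 -> du 0 = 0 ->
  (forall y, is_derive u y (du y)) ->
  (forall y, is_derive du y (P y - K^2 * u y)) ->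
  (forall y, 0 < y < b -> 0 < P y) ->
  forall y, 0 < y < b -> 0 < u y /\ 0 < du y.
Proof.
  intros HK Hb Hu0 Hdu0 Hu Hdu HP.
  assert (Hsc : forall y, 0 < y < b -> 0 < sin (K * y) /\ 0 < cos (K * y)).
  { intros y Hy. assert (HPI := PI_RGT_0).
    split; [apply sin_gt_0|apply cos_gt_0]; nra. }
  assert (H1 : forall y, 0 < y < b -> 0 < du y * sin (K * y) - u y * (K * cos (K * y))).
  { apply (pos_increasing_from_0 _ (fun y => P y * sin (K * y))).
    - rewrite Hu0, Hdu0. ring.
    - intros y. evar_last.
      + apply (is_derive_minus (fun y => du y * sin (K * y))
          (fun y => u y * (K * cos (K * y)))).
        * apply (is_derive_mult du (fun y => sin (K * y)));
            [apply Hdu|auto_derive; [easy|reflexivity]|intros; apply Rmult_comm].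
        * apply (is_derive_mult u (fun y => K * cos (K * y)));
            [apply Hu|auto_derive; [easy|reflexivity]|intros; apply Rmult_comm].
      + unfold minus, plus, opp, mult; simpl. unfold mult; simpl. ring.
    - intros y Hy. apply Rmult_lt_0_compat; [now apply HP|now apply Hsc]. }
  assert (H2 : forall y, 0 < y < b -> 0 < du y * cos (K * y) + u y * (K * sin (K * y))).
  { apply (pos_increasing_from_0 _ (fun y => P y * cos (K * y))).
    - rewrite Hu0, Hdu0. ring.
    - intros y. evar_last.
      + apply (is_derive_plus (fun y => du y * cos (K * y))
          (fun y => u y * (K * sin (K * y)))).
        * apply (is_derive_mult du (fun y => cos (K * y)));
            [apply Hdu|auto_derive; [easy|reflexivity]|intros; apply Rmult_comm].
        * apply (is_derive_mult u (fun y => K * sin (K * y)));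
            [apply Hu|auto_derive; [easy|reflexivity]|intros; apply Rmult_comm].
      + unfold minus, plus, opp, mult; simpl. unfold mult; simpl. ring.
    - intros y Hy. apply Rmult_lt_0_compat; [now apply HP|now apply Hsc]. }
  assert (H3 : forall y, 0 < y < b -> 0 < du y).
  { intros y Hy. specialize (H1 y Hy). specialize (H2 y Hy).
    destruct (Hsc y Hy) as [Hs Hc]. assert (H := sin2_cos2 (K * y)). unfold Rsqr in H.
    replace (du y) with
      ((du y * sin (K * y) - u y * (K * cos (K * y))) * sin (K * y)
       + (du y * cos (K * y) + u y * (K * sin (K * y))) * cos (K * y)).
    - apply Rplus_lt_0_compat; now apply Rmult_lt_0_compat.
    - rewrite <- (Rmult_1_r (du y)) at 3. rewrite <- H. ring. }
  intros y Hy. split; [|now apply H3]. now apply (pos_increasing_from_0 u du b).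
Qed.

(** The energy [u'^2 + K^2 u^2] is conserved. *)
Lemma oscillator_unique (u du : R -> R) (K x0 : R) :
  K <> 0 -> u x0 = 0 -> du x0 = 0 ->
  (forall y, is_derive u y (du y)) ->
  (forall y, is_derive du y (- K^2 * u y)) ->
  forall y, u y = 0.
Proof.
  intros HK Hu0 Hdu0 Hu Hdu y.
  set (E := fun y => du y * du y + K^2 * (u y * u y)).
  assert (HE : forall y, is_derive E y 0).
  { intros t. evar_last.
    - apply (is_derive_plus (fun y => du y * du y) (fun y => K^2 * (u y * u y))).
      + apply (is_derive_mult du du); [apply Hdu|apply Hdu|intros; apply Rmult_comm].
      + apply (is_derive_scal (fun y => u y * u y)).
        apply (is_derive_mult u u); [apply Hu|apply Hu|intros; apply Rmult_comm].
    - unfold plus, mult; simpl. unfold mult; simpl. unfold scal; simpl.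
      unfold mult; simpl. ring. }
  assert (Hc : E y = E x0).
  { destruct (Rtotal_order y x0) as [H|[->|H]]; [|easy|].
    - destruct (mvt E (fun _ => 0) y x0 H) as [c [_ Hc]]; [intros; apply HE|lra].
    - destruct (mvt E (fun _ => 0) x0 y H) as [c [_ Hc]]; [intros; apply HE|lra]. }
  unfold E in Hc. rewrite Hu0, Hdu0 in Hc.
  assert (0 < K^2) by now apply pow2_gt_0.
  assert (0 <= du y * du y) by apply Rle_0_sqr.
  assert (0 <= u y * u y) by apply Rle_0_sqr.
  assert (u y * u y = 0) by nra. nra.
Qed.

(* The coefficients are chosen so that [u := contact k (m+1)] solves
   [u'' + (k (m+1))^2 u = contact k m] with [u 0 = u' 0 = 0]; hence [contact k m]
   vanishes to the maximal order [2 m + 1] at [0]. *)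
Fixpoint contact_coef (k : nat -> R) (m n : nat) : R :=
  match m with
  | O => if Nat.eqb n 0 then 1 else 0
  | S m' =>
      if Nat.eqb n m then
        - / k m * sum_f_R0 (fun i => contact_coef k m' i * k i / ((k m)^2 - (k i)^2)) m'
      else contact_coef k m' n / ((k m)^2 - (k n)^2)
  end.

Definition contact (k : nat -> R) (m : nat) : R -> R := sine_comb (contact_coef k m) k m.
Definition contact' (k : nat -> R) (m : nat) : R -> R := sine_comb' (contact_coef k m) k m.

Lemma contact_coef_top (k : nat -> R) (m : nat) :
  contact_coef k (S m) (S m) =
  - / k (S m) * sum_f_R0 (fun i => contact_coef k m i * k i / ((k (S m))^2 - (k i)^2)) m.
Proof. simpl. now rewrite Nat.eqb_refl. Qed.

Lemma contact_coef_step (k : nat -> R) (m n : nat) :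
  n <> S m -> contact_coef k (S m) n = contact_coef k m n / ((k (S m))^2 - (k n)^2).
Proof.
  intros H. apply Nat.eqb_neq in H. cbn [contact_coef]. now rewrite H.
Qed.

Lemma contact_coef_large (k : nat -> R) (m n : nat) :
  (m < n)%nat -> contact_coef k m n = 0.
Proof.
  induction m as [|m IH]; intros Hn.
  - destruct n; [lia|easy].
  - rewrite contact_coef_step, IH by lia. apply Rmult_0_l.
Qed.

(** Padding with zeros lets contact functions of different orders be added as coefficient vectors of
    one length. *)
Lemma sine_comb_contact (k : nat -> R) (m N : nat) (y : R) :
  (m <= N)%nat -> sine_comb (contact_coef k m) k N y = contact k m y.
Proof.
  intros H. induction N as [|N IH].
  - now replace m with 0%nat by lia.
  - destruct (Nat.eq_dec m (S N)) as [->|Hne]; [easy|].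
    rewrite <- IH by lia. unfold sine_comb. rewrite tech5.
    rewrite contact_coef_large by lia. ring.
Qed.

Section Contact.

Variables (k : nat -> R) (N : nat).
Hypothesis Hpos : forall n, (n <= N)%nat -> 0 < k n.
Hypothesis Hinc : forall m n, (m < n)%nat -> (n <= N)%nat -> k m < k n.

Lemma frequencies_sq_diff (m n : nat) :
  (m < n)%nat -> (n <= N)%nat -> (k n)^2 - (k m)^2 <> 0.
Proof.
  intros Hm Hn. assert (H1 := Hpos m ltac:(lia)). assert (H2 := Hinc m n Hm Hn). nra.
Qed.

Lemma is_derive_contact (m : nat) (y : R) : is_derive (contact k m) y (contact' k m y).
Proof. apply is_derive_sine_comb. Qed.

Lemma is_derive_contact' (m : nat) (y : R) : (S m <= N)%nat ->
  is_derive (contact' k (S m)) y (contact k m y - (k (S m))^2 * contact k (S m) y).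
Proof.
  intros Hm. evar_last; [apply is_derive_sine_comb'|].
  unfold contact, sine_comb. rewrite !tech5.
  assert (H : forall n, (n <= m)%nat -> contact_coef k (S m) n =
    contact_coef k m n / ((k (S m))^2 - (k n)^2)).
  { intros n Hn. apply contact_coef_step. lia. }
  set (c := contact_coef k (S m)) in *.
  replace (sum_f_R0 (fun n => contact_coef k m n * sin (k n * y)) m) with
    ((k (S m))^2 * sum_f_R0 (fun n => c n * sin (k n * y)) m
     + -(1) * sum_f_R0 (fun n => (k n)^2 * c n * sin (k n * y)) m); [ring|].
  rewrite !scal_sum, <- plus_sum. apply sum_eq. intros n Hn.
  rewrite H by easy. assert (Hd := frequencies_sq_diff n (S m) ltac:(lia) Hm).
  field. exact Hd.
Qed.

Lemma contact_0 (m : nat) : contact k m 0 = 0.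
Proof. apply sine_comb_0. Qed.

(** The top coefficient is defined to make this hold. *)
Lemma contact'_0 (m : nat) : (S m <= N)%nat -> contact' k (S m) 0 = 0.
Proof.
  intros Hm. unfold contact'. rewrite sine_comb'_0, tech5.
  assert (HK := Hpos (S m) Hm).
  rewrite contact_coef_top.
  replace (sum_f_R0 (fun n => contact_coef k (S m) n * k n) m) with
    (sum_f_R0 (fun i => contact_coef k m i * k i / ((k (S m))^2 - (k i)^2)) m).
  - field. lra.
  - apply sum_eq. intros n Hn.
    rewrite contact_coef_step by lia. unfold Rdiv. ring.
Qed.

(** Each contact function is the positive force driving the next one, starting from [sin (k 0 y)];
    the bound keeps all frequencies within a quarter period. *)
Lemma contact_pos (b : R) (m : nat) : 0 < b -> k N * b <= PI / 2 -> (m <= N)%nat ->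
  forall y, 0 < y < b -> 0 < contact k m y /\ 0 < contact' k m y.
Proof.
  intros Hb HbN. assert (HPI := PI_RGT_0).
  assert (Hkb : forall n, (n <= N)%nat -> k n * b <= PI / 2).
  { intros n Hn. destruct (Nat.eq_dec n N) as [->|]; [easy|].
    assert (k n < k N) by (apply Hinc; lia). nra. }
  induction m as [|m IH]; intros Hm y Hy.
  - assert (H0 := Hpos 0%nat ltac:(lia)). assert (H1 := Hkb 0%nat ltac:(lia)).
    unfold contact, contact', sine_comb, sine_comb'. simpl.
    assert (0 < sin (k 0%nat * y)) by (apply sin_gt_0; nra).
    assert (0 < cos (k 0%nat * y)) by (apply cos_gt_0; nra).
    split; nra.
  - apply (forced_oscillator_pos _ _ (contact k m) (k (S m)) b); try easy.
    + now apply Hpos.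
    + now apply Hkb.
    + apply contact_0.
    + now apply contact'_0.
    + apply is_derive_contact.
    + intros. now apply is_derive_contact'.
    + intros. apply IH; [lia|easy].
Qed.

Lemma contact_increasing (b : R) (m : nat) : 0 < b -> k N * b <= PI / 2 -> (m <= N)%nat ->
  forall x y, 0 <= x <= y -> y < b -> contact k m x <= contact k m y.
Proof.
  intros Hb HbN Hm x y Hx Hy. destruct (Req_dec x y) as [->|Hne]; [lra|].
  destruct (mvt (contact k m) (contact' k m) x y) as [c [Hc He]];
    [lra|intros; apply is_derive_contact|].
  assert (H := contact_pos b m Hb HbN Hm c ltac:(lra)). nra.
Qed.

(** By positivity the second derivative of the next contact function is at most the current one,
    which is increasing; two integrations give [y^2]. This factor lets the lower order dominate near
    0 in [sign_pattern]. *)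
Lemma contact_succ_le (b : R) (m : nat) : 0 < b -> k N * b <= PI / 2 -> (S m <= N)%nat ->
  forall y, 0 < y < b -> contact k (S m) y <= y^2 * contact k m y.
Proof.
  intros Hb HbN Hm.
  assert (H' : forall y, 0 < y < b -> contact' k (S m) y <= y * contact k m y).
  { intros y Hy.
    destruct (mvt (contact' k (S m)) (fun y => contact k m y - (k (S m))^2 * contact k (S m) y) 0 y)
      as [c [Hc He]]; [lra|intros; now apply is_derive_contact'|].
    rewrite contact'_0 in He by easy.
    assert (H1 := contact_pos b (S m) Hb HbN Hm c ltac:(lra)).
    assert (H2 := contact_increasing b m Hb HbN ltac:(lia) c y ltac:(lra) ltac:(lra)).
    assert (0 <= (k (S m))^2 * contact k (S m) c) by (apply Rmult_le_pos; [apply pow2_ge_0|lra]).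
    nra. }
  intros y Hy.
  destruct (mvt (contact k (S m)) (contact' k (S m)) 0 y) as [c [Hc He]];
    [lra|intros; apply is_derive_contact|].
  rewrite contact_0 in He. specialize (H' c ltac:(lra)).
  assert (H2 := contact_increasing b m Hb HbN ltac:(lia) c y ltac:(lra) ltac:(lra)).
  assert (H3 := proj1 (contact_pos b m Hb HbN ltac:(lia) c ltac:(lra))).
  assert (c * contact k m c <= y * contact k m y) by (apply Rmult_le_compat; lra).
  nra.
Qed.

Lemma is_lim_seq_contact_coef (ki : nat -> nat -> R) (m n : nat) :
  (forall n, (n <= N)%nat -> is_lim_seq (fun i => ki i n) (k n)) ->
  (m <= N)%nat -> (n <= N)%nat ->
  is_lim_seq (fun i => contact_coef (ki i) m n) (contact_coef k m n).
Proof.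
  intros Hk. revert n.
  assert (Hsq : forall m n, (m <= N)%nat -> (n <= N)%nat ->
    is_lim_seq (fun i => (ki i m)^2 - (ki i n)^2) ((k m)^2 - (k n)^2)).
  { intros. apply is_lim_seq_minus'; simpl;
      (apply is_lim_seq_mult'; [now apply Hk|]; apply is_lim_seq_mult';
        [now apply Hk|apply is_lim_seq_const]). }
  induction m as [|m IH]; intros n Hm Hn.
  - simpl. destruct (Nat.eqb n 0); apply is_lim_seq_const.
  - destruct (Nat.eq_dec n (S m)) as [->|Hne].
    + rewrite contact_coef_top.
      apply is_lim_seq_ext with (fun i => - / ki i (S m) * sum_f_R0 (fun j =>
        contact_coef (ki i) m j * ki i j / ((ki i (S m))^2 - (ki i j)^2)) m);
        [intros; now rewrite contact_coef_top|].
      apply is_lim_seq_mult'.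
      * apply is_lim_seq_opp'.
        apply (is_lim_seq_inv (fun i => ki i (S m)) (k (S m))); [now apply Hk|].
        intros [= H]. assert (Hp := Hpos (S m) Hm). lra.
      * apply (is_lim_seq_sum (fun i j =>
          contact_coef (ki i) m j * ki i j / ((ki i (S m))^2 - (ki i j)^2))).
        intros j Hj. apply is_lim_seq_div'.
        -- apply is_lim_seq_mult'; [apply IH; lia|apply Hk; lia].
        -- apply Hsq; lia.
        -- apply frequencies_sq_diff; lia.
    + rewrite contact_coef_step by easy.
      apply is_lim_seq_ext with (fun i =>
        contact_coef (ki i) m n / ((ki i (S m))^2 - (ki i n)^2));
        [intros; now rewrite contact_coef_step|].
      apply is_lim_seq_div'; [apply IH; lia|apply Hsq; lia|].
      destruct (Nat.lt_total n (S m)) as [H|[H|H]]; [|easy|].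
      * now apply frequencies_sq_diff.
      * assert (Hd := frequencies_sq_diff _ _ H Hn). lra.
Qed.

End Contact.

(** * The limiting frequencies *)

Definition int_freq (n : nat) : R := INR (S n) * PI.

Lemma int_freq_pos (n : nat) : 0 < int_freq n.
Proof. apply Rmult_lt_0_compat; [apply lt_0_INR; lia|apply PI_RGT_0]. Qed.

Lemma int_freq_increasing (m n : nat) : (m < n)%nat -> int_freq m < int_freq n.
Proof.
  intros H. apply Rmult_lt_compat_r; [apply PI_RGT_0|]. apply lt_INR. lia.
Qed.

(** The product is a sine polynomial with frequencies pi, ..., (m+1) pi vanishing to order 2m+1 at
    0. The proof checks that it obeys the recursion defining the contact functions and invokes
    uniqueness for the oscillator. *)
Lemma contact_int_freq (m : nat) :
  exists C, 0 < C /\ forall y,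
    contact int_freq m y = C * (sin (PI * y) * (1 - cos (PI * y)) ^ m).
Proof.
  induction m as [|m [C [HC IH]]].
  - exists 1. split; [lra|]. intros y. unfold contact, sine_comb, int_freq. simpl.
    rewrite (Rmult_1_l PI). ring.
  (* Applying [d^2/dy^2 + K^2] with K = (m+2) pi to the product of exponent m+1 gives [q] times the
     product of exponent m. *)
  - set (q := PI^2 * (INR (S m) * (2 * INR m + 3))).
    assert (Hq : 0 < q).
    { apply Rmult_lt_0_compat; [apply pow2_gt_0, Rgt_not_eq, PI_RGT_0|].
      assert (0 <= INR m) by apply pos_INR. rewrite S_INR. nra. }
    exists (C / q). split; [now apply Rdiv_lt_0_compat|].
    set (K := int_freq (S m)).
    set (T := fun y => C / q * (sin (PI * y) * (1 - cos (PI * y)) ^ (S m))).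
    (* The squared sine is eliminated here, so [T'] is a polynomial in the cosine and a second
       differentiation produces a single factor [sin (PI * y)]. *)
    set (T' := fun y => C / q * (PI * ((1 - cos (PI * y)) ^ (S m) *
      ((2 * INR m + 3) - (INR m + 2) * (1 - cos (PI * y)))))).
    assert (HT : forall y, is_derive T y (T' y)).
    { intros y. unfold T, T'. auto_derive; [easy|].
      change (match m with O => 1 | S _ => INR m + 1 end) with (INR (S m)).
      change (1 + - cos (PI * y)) with (1 - cos (PI * y)).
      rewrite S_INR. simpl pow.
      assert (H := sin2_cos2 (PI * y)). unfold Rsqr in H.
      assert (Hs : sin (PI * y) * sin (PI * y) = 1 - cos (PI * y) * cos (PI * y)) by lra.
      set (w := (1 - cos (PI * y)) ^ m). set (c := cos (PI * y)) in *.
      transitivity (C / q * (PI * (c * ((1 - c) * w)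
        + (INR m + 1) * (sin (PI * y) * sin (PI * y)) * w))).
      - ring.
      - rewrite Hs. ring. }
    assert (HT' : forall y, is_derive T' y
      (C * (sin (PI * y) * (1 - cos (PI * y)) ^ m) - K^2 * T y)).
    { intros y. unfold T, T'. auto_derive; [easy|].
      change (match m with O => 1 | S _ => INR m + 1 end) with (INR (S m)).
      change (1 + - cos (PI * y)) with (1 - cos (PI * y)).
      unfold K, int_freq. rewrite !S_INR. simpl pow.
      set (w := (1 - cos (PI * y)) ^ m). set (c := cos (PI * y)).
      unfold q. rewrite S_INR. assert (0 <= INR m) by apply pos_INR.
      assert (HPI := PI_RGT_0).
      field. repeat split; lra. }
    intros y. apply Rminus_diag_uniq.
    apply (oscillator_unique (fun y => contact int_freq (S m) y - T y)
      (fun y => contact' int_freq (S m) y - T' y) K 0).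
    + apply Rgt_not_eq, int_freq_pos.
    + unfold T. rewrite contact_0, Rmult_0_r, sin_0. ring.
    + rewrite (contact'_0 _ (S m)); [|intros; apply int_freq_pos|easy].
      unfold T'. rewrite Rmult_0_r, cos_0, Rminus_diag, pow_ne_zero by easy. ring.
    + intros t. apply (is_derive_minus (contact int_freq (S m)) T);
        [apply is_derive_contact|apply HT].
    + intros t. evar_last.
      * apply (is_derive_minus (contact' int_freq (S m)) T'); [|apply HT'].
        apply (is_derive_contact' _ (S m));
          [intros; apply int_freq_pos|intros; now apply int_freq_increasing|easy].
      * unfold minus, plus, opp; simpl. rewrite <- IH. unfold K. simpl. ring.
Qed.

(** * One long edge and equal short edges *)

(** The bound serves twice: short edges have no positive pole up to [M * PI], and the first [M]
    frequencies satisfy [k * l j < PI], as [sine_comb_zeros] requires. *)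
Definition admissible (s M : nat) (l : nat -> R) : Prop :=
  l 0%nat = 1 /\ forall j, (1 <= j <= s)%nat -> 0 < l j /\ l j * INR M < 1.

(* The frequency of the (n+1)-st eigenfunction: if the other edges are shorter
   than [1 / M], the first poles of the secular function come from edge [0]. *)
Definition freq (s : nat) (l : nat -> R) (n : nat) : R :=
  cot_root s l (INR n * PI) (INR (S n) * PI).

Lemma admissible_pos (s M : nat) (l : nat -> R) (j : nat) :
  admissible s M l -> (j <= s)%nat -> 0 < l j.
Proof.
  intros [H0 H] Hj. destruct j as [|j]; [rewrite H0; lra|apply H; lia].
Qed.

Lemma sin_neq_0_between (n : nat) (k : R) :
  INR n * PI < k < INR (S n) * PI -> sin k <> 0.
Proof.
  intros Hk H0. apply sin_eq_0_0 in H0. destruct H0 as [z ->].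
  assert (HPI := PI_RGT_0). destruct Hk as [H1 H2].
  apply Rmult_lt_reg_r in H1, H2; try easy.
  rewrite INR_IZR_INZ in H1, H2. apply lt_IZR in H1, H2. lia.
Qed.

Lemma sin_INR_PI (n : nat) : sin (INR n * PI) = 0.
Proof. apply sin_eq_0_1. exists (Z.of_nat n). now rewrite <- INR_IZR_INZ. Qed.

Lemma INR_succ_le (n M : nat) : (n < M)%nat -> INR (S n) <= INR M.
Proof. intros H. apply le_INR. lia. Qed.

Section Freq.

Variables (s M : nat).

Lemma admissible_pole_free (l : nat -> R) (n : nat) :
  admissible s M l -> (n < M)%nat ->
  pole_free s l (INR n * PI) (INR (S n) * PI).
Proof.
  intros [H0 H] Hn j k Hj Hk. assert (HPI := PI_RGT_0).
  destruct j as [|j].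
  - rewrite H0, Rmult_1_r. now apply sin_neq_0_between with n.
  - destruct (H (S j)) as [Hl Hl']; [lia|]. assert (HM := INR_succ_le n M Hn).
    assert (Hn0 := pos_INR n).
    apply Rgt_not_eq, sin_gt_0.
    + apply Rmult_lt_0_compat; nra.
    + apply Rlt_trans with (INR (S n) * PI * l (S j)); [nra|].
      apply Rle_lt_trans with (INR M * PI * l (S j)); [|nra].
      apply Rmult_le_compat_r; [lra|nra].
Qed.

Lemma freq_spec (l : nat -> R) (n : nat) :
  admissible s M l -> (n < M)%nat ->
  INR n * PI < freq s l n < INR (S n) * PI /\ cot_sum s l (freq s l n) = 0.
Proof.
  intros Hl Hn. apply cot_root_spec.
  - intros. now apply admissible_pos with s M.
  - now apply admissible_pole_free.
  - rewrite S_INR. assert (HPI := PI_RGT_0). lra.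
  - exists 0%nat. rewrite (proj1 Hl), Rmult_1_r, sin_INR_PI. split; [lia|easy].
  - exists 0%nat. rewrite (proj1 Hl), Rmult_1_r, sin_INR_PI. split; [lia|easy].
Qed.

Lemma freq_pos (l : nat -> R) (n : nat) :
  admissible s M l -> (n < M)%nat -> 0 < freq s l n.
Proof.
  intros Hl Hn. destruct (freq_spec l n Hl Hn) as [H _].
  assert (Hn0 := pos_INR n). assert (HPI := PI_RGT_0). nra.
Qed.

Lemma freq_increasing (l : nat -> R) (m n : nat) :
  admissible s M l -> (m < n)%nat -> (n < M)%nat -> freq s l m < freq s l n.
Proof.
  intros Hl Hm Hn. destruct (freq_spec l n Hl Hn) as [H _].
  destruct (freq_spec l m Hl ltac:(lia)) as [H' _].
  assert (HPI := PI_RGT_0). assert (INR (S m) <= INR n) by (apply le_INR; lia). nra.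
Qed.

Lemma freq_lt_PI_mul (l : nat -> R) (n : nat) (c : R) :
  admissible s M l -> (n < M)%nat -> 0 < c -> freq s l n * c < PI * (INR M * c).
Proof.
  intros Hl Hn Hc. destruct (freq_spec l n Hl Hn) as [H _].
  assert (HM := INR_succ_le n M Hn). assert (HPI := PI_RGT_0).
  replace (PI * (INR M * c)) with (INR M * PI * c) by ring.
  apply Rmult_lt_compat_r; [easy|]. nra.
Qed.

Lemma sin_freq_neq_0 (l : nat -> R) (n j : nat) :
  admissible s M l -> (n < M)%nat -> (j <= s)%nat -> sin (freq s l n * l j) <> 0.
Proof.
  intros Hl Hn Hj. apply (admissible_pole_free l n Hl Hn j); [easy|].
  now apply freq_spec.
Qed.

Lemma freq_continuous (li : nat -> nat -> R) (l : nat -> R) (n : nat) :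
  (forall i, admissible s M (li i)) -> admissible s M l ->
  (forall j, (j <= s)%nat -> is_lim_seq (fun i => li i j) (l j)) -> (n < M)%nat ->
  is_lim_seq (fun i => freq s (li i) n) (freq s l n).
Proof.
  intros Hli Hl Hlim Hn.
  apply (cot_root_continuous s li l (INR n * PI) (INR (S n) * PI)); try easy.
  - intros. now apply admissible_pos with s M.
  - intros. now apply admissible_pos with s M.
  - intros. now apply admissible_pole_free.
  - now apply admissible_pole_free.
  - intros. now apply freq_spec.
  - now apply freq_spec.
  - now apply freq_spec.
Qed.

Definition equal_lengths (e : R) (j : nat) : R :=
  match j with O => 1 | S _ => e end.

Lemma cot_sum_equal (e k : R) :
  cot_sum s (equal_lengths e) k =
  cos k / sin k + INR s * (cos (k * e) / sin (k * e)).
Proof.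
  unfold cot_sum. induction s as [|s' IH].
  - simpl. rewrite Rmult_1_r. ring.
  - rewrite tech5, IH, S_INR. simpl equal_lengths. ring.
Qed.

Lemma equal_admissible (e : R) :
  0 < e -> e * INR M < 1 -> admissible s M (equal_lengths e).
Proof.
  intros He HM. split; [easy|]. intros [|j] Hj; [lia|easy].
Qed.

(** The values of epsilon. The offset gives [epsilon * M <= 1/4]: room for a perturbation that
    multiplies a length by less than 3, and for [x + epsilon] to stay below 1/(2M) near the
    centre. *)
Definition inv_seq (i : nat) : R := / INR (i + S (4 * M)).

Lemma inv_seq_facts (i : nat) : (0 < M)%nat -> 0 < inv_seq i /\ inv_seq i * INR M <= 1 / 4.
Proof.
  intros HM. unfold inv_seq.
  assert (H : 4 * INR M <= INR (i + S (4 * M))).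
  { rewrite plus_INR, S_INR, mult_INR. assert (H := pos_INR i).
    replace (INR 4) with 4 by (simpl; lra). lra. }
  assert (0 < INR M) by (apply lt_0_INR; lia).
  split; [apply Rinv_0_lt_compat; lra|].
  apply Rmult_le_reg_l with (INR (i + S (4 * M))); [lra|].
  rewrite <- Rmult_assoc, Rinv_r; lra.
Qed.

Hypothesis Hs : (0 < s)%nat.

Lemma equal_freq_facts (e : R) (n : nat) :
  0 < e -> e * INR M <= 1 / 4 -> (n < M)%nat ->
  let k := freq s (equal_lengths e) n in
  sin k <> 0 /\ 0 < sin (k * e) /\ 0 < cos (k * e) /\
  cos k * sin (k * e) = - INR s * (cos (k * e) * sin k).
Proof.
  intros He HM Hn k. assert (Hadm := equal_admissible e He ltac:(lra)).
  destruct (freq_spec _ n Hadm Hn) as [Hk Hk0]. fold k in Hk, Hk0.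
  assert (Hk1 := freq_lt_PI_mul _ n e Hadm Hn He). fold k in Hk1.
  assert (Hkp := freq_pos _ n Hadm Hn). fold k in Hkp.
  assert (HPI := PI_RGT_0).
  assert (Hsk := sin_neq_0_between n k Hk).
  assert (0 < k * e) by nra. assert (k * e < PI / 2) by nra.
  assert (Hse : 0 < sin (k * e)) by (apply sin_gt_0; lra).
  assert (Hce : 0 < cos (k * e)) by (apply cos_gt_0; lra).
  rewrite cot_sum_equal in Hk0. repeat split; try easy.
  replace (cos k * sin (k * e)) with
    ((cos k / sin k + INR s * (cos (k * e) / sin (k * e))) * (sin k * sin (k * e))
     - INR s * (cos (k * e) * sin k)) by (field; split; lra).
  rewrite Hk0. ring.
Qed.

(** With th = (n+1) pi - k the secular equation reads tan(k e) = s tan(th), so s >= 1 forces th <= k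
    e. Otherwise sin(th - k e) would be positive, yet it equals (1 - s) sin(th) cos(k e). *)
Lemma equal_freq_near (e : R) (n : nat) :
  0 < e -> e * INR M <= 1 / 4 -> (n < M)%nat ->
  int_freq n - PI * (INR M * e) <= freq s (equal_lengths e) n <= int_freq n.
Proof.
  intros He HM Hn. assert (Hadm := equal_admissible e He ltac:(lra)).
  destruct (freq_spec _ n Hadm Hn) as [Hk _].
  assert (Hk1 := freq_lt_PI_mul _ n e Hadm Hn He).
  destruct (equal_freq_facts e n He HM Hn) as [Hsk [Hse [Hce Heq]]].
  assert (Hkp := freq_pos _ n Hadm Hn).
  set (k := freq s (equal_lengths e) n) in *.
  unfold int_freq. split; [|lra]. apply Rnot_lt_le. intros Hlt.
  set (th := INR (S n) * PI - k) in *.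
  assert (HPI := PI_RGT_0). rewrite S_INR in Hk.
  assert (Hth : k * e < th < PI) by (unfold th; rewrite S_INR in *; lra).
  assert (Hsth : 0 < sin th) by (apply sin_gt_0; nra).
  assert (H1 : 0 < sin (th - k * e)) by (apply sin_gt_0; nra).
  assert (Hc2 : cos (INR (S n) * PI) * cos (INR (S n) * PI) = 1).
  { assert (H := sin2_cos2 (INR (S n) * PI)). rewrite sin_INR_PI in H.
    unfold Rsqr in H. lra. }
  assert (Hth' : sin th = - cos (INR (S n) * PI) * sin k).
  { unfold th. rewrite sin_minus, sin_INR_PI. ring. }
  assert (Hcth : cos th = cos (INR (S n) * PI) * cos k).
  { unfold th. rewrite cos_minus, sin_INR_PI. ring. }
  rewrite sin_minus in H1.
  assert (H2 : cos th * sin (k * e) = INR s * (cos (k * e) * sin th)).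
  { rewrite Hcth, Hth', Rmult_assoc, Heq. ring. }
  rewrite H2 in H1.
  assert (1 <= INR s) by (apply (le_INR 1); lia).
  assert (0 < sin th * cos (k * e)) by now apply Rmult_lt_0_compat.
  nra.
Qed.

Lemma is_lim_equal_freq (n : nat) : (n < M)%nat ->
  is_lim_seq (fun i => freq s (equal_lengths (inv_seq i)) n) (int_freq n).
Proof.
  intros Hn.
  apply is_lim_seq_le_le with
    (fun i => int_freq n - PI * (INR M * inv_seq i)) (fun _ => int_freq n).
  - intros i. destruct (inv_seq_facts i) as [H1 H2]; [lia|]. now apply equal_freq_near.
  - replace (int_freq n) with (int_freq n - PI * (INR M * 0)) at 1 by ring.
    apply is_lim_seq_minus'; [apply is_lim_seq_const|].
    repeat (apply is_lim_seq_mult'; [apply is_lim_seq_const|]).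
    apply is_lim_seq_inv_nat.
  - apply is_lim_seq_const.
Qed.

Lemma cos_int_freq_sq (n : nat) : cos (int_freq n) * cos (int_freq n) = 1.
Proof.
  assert (H := sin2_cos2 (int_freq n)). unfold int_freq in *.
  rewrite sin_INR_PI in H. unfold Rsqr in H. lra.
Qed.

(** This factor converts short-edge coefficients into long-edge ones. Both sines tend to 0; the
    secular equation replaces their quotient by a quotient of cosines, and at the limit
    [1 / cos = cos] since the cosine is 1 or -1. *)
Lemma is_lim_equal_ratio (n : nat) : (n < M)%nat ->
  is_lim_seq (fun i => let k := freq s (equal_lengths (inv_seq i)) n in
    sin (k * inv_seq i) / sin k) (- INR s * cos (int_freq n)).
Proof.
  intros Hn. set (ki := fun i => freq s (equal_lengths (inv_seq i)) n).
  assert (Hc := cos_int_freq_sq n).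
  assert (Hc0 : cos (int_freq n) <> 0) by (intros H0; rewrite H0 in Hc; lra).
  apply is_lim_seq_ext with (fun i => - INR s * (cos (ki i * inv_seq i) / cos (ki i))).
  - intros i. unfold ki. destruct (inv_seq_facts i) as [H1 H2]; [lia|].
    destruct (equal_freq_facts (inv_seq i) n H1 H2 Hn) as [Hsk [Hse [Hce Heq]]].
    simpl. set (k := freq s (equal_lengths (inv_seq i)) n) in *.
    assert (1 <= INR s) by (apply (le_INR 1); lia).
    assert (cos k <> 0).
    { intros H0. rewrite H0, Rmult_0_l in Heq. symmetry in Heq.
      apply Rmult_integral in Heq. destruct Heq as [Heq|Heq]; [lra|].
      apply Rmult_integral in Heq. destruct Heq; [lra|easy]. }
    apply Rmult_eq_reg_r with (cos k * sin k); [|now apply Rmult_integral_contrapositive].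
    transitivity (- INR s * (cos (k * inv_seq i) * sin k)); [field; easy|].
    rewrite <- Heq. field. easy.
  - replace (- INR s * cos (int_freq n)) with
      (- INR s * (cos (int_freq n * 0) / cos (int_freq n))).
    + apply is_lim_seq_mult'; [apply is_lim_seq_const|].
      apply is_lim_seq_div'; [| |easy].
      * apply (is_lim_seq_continuous cos); [apply continuity_cos|].
        apply is_lim_seq_mult'; [now apply is_lim_equal_freq|apply is_lim_seq_inv_nat].
      * apply (is_lim_seq_continuous cos); [apply continuity_cos|].
        now apply is_lim_equal_freq.
    + rewrite Rmult_0_r, cos_0. f_equal. apply Rmult_eq_reg_r with (cos (int_freq n)); [|easy].
      rewrite Hc. field. easy.
Qed.

(** At multiples of pi, sin(k (1 - z)) = - cos(k) sin(k z), so this sum is s times the explicit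
    contact function read from the other end. The centre [z = 1], where it vanishes, is excluded. *)
Lemma limit_long_edge_pos (N : nat) (c : R) : 0 < c < 1 ->
  pos_comb (fun n => contact_coef int_freq N n * (- INR s * cos (int_freq n))) int_freq N c.
Proof.
  intros Hc. assert (Hs' : 0 < INR s) by now apply lt_0_INR.
  assert (HPI := PI_RGT_0).
  destruct (contact_int_freq N) as [C [HC HG]].
  set (f := fun z => INR s * (C * (sin (PI * (1 - z)) * (1 - cos (PI * (1 - z))) ^ N))).
  assert (Hf : forall z, f z = sine_comb
    (fun n => contact_coef int_freq N n * (- INR s * cos (int_freq n))) int_freq N z).
  { intros z. unfold f. rewrite <- HG. unfold contact, sine_comb. rewrite scal_sum.
    apply sum_eq. intros n _.
    replace (int_freq n * (1 - z)) with (int_freq n - int_freq n * z) by ring.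
    rewrite sin_minus. replace (sin (int_freq n)) with 0 by (symmetry; apply sin_INR_PI).
    ring. }
  split.
  - rewrite <- sine_comb'_0.
    assert (H1 : is_derive f 0 (INR s * (C * (PI * 2 ^ N)))).
    { unfold f. auto_derive; [easy|]. replace (1 + -0) with 1 by ring.
      rewrite Rmult_1_r, sin_PI, cos_PI. replace (1 + - -1) with 2 by ring. ring. }
    apply is_derive_unique in H1.
    rewrite <- (is_derive_unique _ _ _ (is_derive_sine_comb _ _ _ _)).
    rewrite <- (Derive_ext f _ 0 Hf), H1.
    assert (H2 : 0 < 2 ^ N) by (apply pow_lt; lra).
    apply Rmult_lt_0_compat; [easy|]. apply Rmult_lt_0_compat; [easy|].
    now apply Rmult_lt_0_compat.
  - intros z Hz. rewrite <- Hf. unfold f.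
    apply Rmult_lt_0_compat; [easy|]. apply Rmult_lt_0_compat; [easy|].
    apply Rmult_lt_0_compat.
    + apply sin_gt_0; nra.
    + apply pow_lt. assert (0 < PI * z) by (apply Rmult_lt_0_compat; lra).
      assert (0 < PI * (1 - z)) by (apply Rmult_lt_0_compat; lra).
      assert (Hcs : cos (PI * (1 - z)) < cos 0) by (apply cos_decreasing_1; lra).
      rewrite cos_0 in Hcs. lra.
Qed.

(** Here [x] is the distance to the centre. The secular equation turns each term into sin(k e) cos(k
    x) + s cos(k e) sin(k x), and its expansion in sin(k (x + e)) and sin(k (x - e)) has
    coefficients independent of k, so it holds for the whole combination. *)
Lemma equal_long_edge_split (e : R) (a : nat -> R) (N : nat) (x : R) :
  0 < e -> e * INR M <= 1 / 4 -> (N < M)%nat ->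
  let k := freq s (equal_lengths e) in
  sine_comb (fun n => a n * (sin (k n * e) / sin (k n))) k N (1 - x) =
  (INR s + 1) / 2 * sine_comb a k N (x + e) + (INR s - 1) / 2 * sine_comb a k N (x - e).
Proof.
  intros He HM HN k. unfold sine_comb. rewrite !scal_sum, <- plus_sum.
  apply sum_eq. intros n Hn.
  destruct (equal_freq_facts e n He HM ltac:(lia)) as [Hsk [_ [_ Heq]]].
  fold k in Hsk, Heq.
  replace (k n * (1 - x)) with (k n - k n * x) by ring.
  rewrite Rmult_plus_distr_l, Rmult_minus_distr_l, sin_plus, !sin_minus.
  transitivity (a n * (sin (k n * e) * cos (k n * x)
    - cos (k n) * sin (k n * e) * sin (k n * x) / sin (k n))); [field; easy|].
  rewrite Heq. field. easy.
Qed.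

Lemma equal_long_edge_pos (HM : (0 < M)%nat) :
  exists i, let e := inv_seq i in let k := freq s (equal_lengths e) in
  forall N, (N < M)%nat ->
  pos_comb (fun n => contact_coef k N n * (sin (k n * e) / sin (k n))) k N 1.
Proof.
  set (ki := fun i => freq s (equal_lengths (inv_seq i))).
  assert (HM1 : 1 <= INR M) by (apply (le_INR 1); lia).
  assert (HMi : / INR M * INR M = 1) by (apply Rinv_l; lra).
  assert (HMi1 : 0 < / INR M) by (apply Rinv_0_lt_compat; lra).
  assert (HMi2 : / INR M <= 1) by (rewrite <- Rinv_1; apply Rinv_le_contravar; lra).
  assert (Hev : eventually (fun i => forall N, (N < M)%nat -> pos_comb
    (fun n => contact_coef (ki i) N n * (sin (ki i n * inv_seq i) / sin (ki i n)))
    (ki i) N (1 - / INR M / 4))).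
  { apply eventually_bounded_forall. intros N HN.
    eapply (pos_comb_stable
      (fun i n => contact_coef (ki i) N n * (sin (ki i n * inv_seq i) / sin (ki i n))) ki).
    - lra.
    - intros n Hn. apply is_lim_seq_mult'.
      + apply (is_lim_seq_contact_coef int_freq N).
        * intros; apply int_freq_pos.
        * intros; now apply int_freq_increasing.
        * intros. apply is_lim_equal_freq. lia.
        * easy.
        * easy.
      + apply is_lim_equal_ratio. lia.
    - intros n Hn. apply is_lim_equal_freq. lia.
    - apply limit_long_edge_pos. lra. }
  destruct Hev as [i Hi]. exists i. intros e k N HN.
  specialize (Hi i (le_n _) N HN). fold e in Hi. change (ki i) with k in Hi.
  destruct Hi as [HD Hi]. split; [easy|]. intros z Hz.
  (* Up to distance 1/(4M) from the centre the limit decides; the rest uses the splitting at the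
     fixed epsilon. *)
  destruct (Rle_dec z (1 - / INR M / 4)) as [Hz'|Hz']; [apply Hi; lra|].
  destruct (inv_seq_facts i HM) as [He HeM]. fold e in He, HeM.
  assert (Hadm := equal_admissible e He ltac:(lra)).
  assert (Hb0 : 0 < / INR M / 2) by lra.
  (* All frequencies are below [M * PI], so 1/(2M) lies within a quarter period; it bounds [x + e],
     both summands being at most 1/(4M). *)
  assert (Hkb : k N * (/ INR M / 2) <= PI / 2).
  { assert (H := freq_lt_PI_mul _ N (/ INR M / 2) Hadm HN Hb0). fold k in H.
    replace (PI * (INR M * (/ INR M / 2))) with (PI / 2) in H by (field; lra). lra. }
  assert (Hkp : forall n, (n <= N)%nat -> 0 < k n)
    by (intros; apply freq_pos; [easy|lia]).
  assert (Hki : forall m n, (m < n)%nat -> (n <= N)%nat -> k m < k n)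
    by (intros; apply freq_increasing; [easy|easy|lia]).
  assert (He4 : e <= / INR M / 4) by nra.
  replace z with (1 - (1 - z)) by ring. set (x := 1 - z) in *.
  assert (Hsplit := equal_long_edge_split e (contact_coef k N) N x He HeM HN).
  cbv zeta in Hsplit. fold k in Hsplit. rewrite Hsplit.
  change (sine_comb (contact_coef k N) k N) with (contact k N).
  assert (HG := proj1 (contact_pos k N Hkp Hki _ N Hb0 Hkb (le_n _) (x + e)
    ltac:(unfold x in *; lra))).
  (* By oddness and monotonicity. The weights (s+1)/2 and (s-1)/2 differ by 1, so the split sum is
     at least [contact k N (x + e)]. *)
  assert (HG' : - contact k N (x + e) <= contact k N (x - e)).
  { destruct (Rle_dec 0 (x - e)) as [Hxe|Hxe].
    - assert (H := contact_increasing k N Hkp Hki _ N Hb0 Hkb (le_n _) 0 (x - e)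
        ltac:(lra) ltac:(unfold x in *; lra)).
      rewrite contact_0 in H. lra.
    - replace (x - e) with (- (e - x)) by ring. unfold contact at 2.
      rewrite sine_comb_odd. apply Ropp_le_contravar.
      apply (contact_increasing k N Hkp Hki _ N Hb0 Hkb (le_n _)); unfold x in *; lra. }
  assert (1 <= INR s) by (apply (le_INR 1); lia).
  nra.
Qed.

End Freq.

(* Start from [contact k N] and successively add multiples, of alternating sign
   and much smaller, of [contact k (N-1)], [contact k (N-2)], ...; the new term
   dominates closer to [0], where it creates one more sign change. *)
Lemma sign_pattern (k beta : nat -> R) (N : nat) (b : R) :
  (forall n, (n <= N)%nat -> 0 < k n) ->
  (forall m n, (m < n)%nat -> (n <= N)%nat -> k m < k n) ->
  0 < b -> k N * b <= PI / 2 ->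
  pos_comb (fun n => contact_coef k N n * beta n) k N 1 ->
  forall i, (i <= N)%nat -> exists (a : nat -> R) (sg C : R),
    sg * sg = 1 /\ 0 < C /\
    pos_comb (fun n => a n * beta n) k N 1 /\
    sign_chain (sine_comb a k N) sg 0 b (S i) /\
    forall y, 0 < y < b -> Rabs (sine_comb a k N y) <= C * contact k (N - i) y.
Proof.
  intros Hpos Hinc Hb Hkb Hlong. induction i as [|i IH]; intros Hi.
  - exists (contact_coef k N), 1, 1.
    split; [ring|]. split; [lra|]. split; [easy|]. split.
    + exists (b / 2). split; [lra|]. split; [|easy]. rewrite Rmult_1_l.
      apply (contact_pos k N Hpos Hinc b N Hb Hkb (le_n _)). lra.
    + intros y Hy. rewrite Nat.sub_0_r, Rmult_1_l. fold (contact k N).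
      assert (H := proj1 (contact_pos k N Hpos Hinc b N Hb Hkb (le_n _) y Hy)).
      rewrite Rabs_right; [apply Rle_refl|]. apply Rle_ge, Rlt_le. exact H.
  - destruct (IH ltac:(lia)) as [a [sg [C [Hsg [HC [Hp [Hch Hbd]]]]]]].
    set (m := (N - S i)%nat). replace (N - i)%nat with (S m) in Hbd by (unfold m; lia).
    assert (Hm : (S m <= N)%nat) by (unfold m; lia).
    set (tau := fun j => / INR (j + 1)).
    assert (Htau : is_lim_seq tau 0) by apply is_lim_seq_inv_nat.
    (* The sign is opposite to that of the leftmost point of the chain; smallness is expressed by
       [tau] tending to 0, so that both stability lemmas apply. *)
    set (aj := fun j n => a n + - sg * tau j * contact_coef k m n).
    assert (Haj : forall n, is_lim_seq (fun j => aj j n) (a n)).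
    { intros n. replace (a n) with (a n + - sg * 0 * contact_coef k m n) at 1 by ring.
      apply is_lim_seq_plus'; [apply is_lim_seq_const|].
      repeat apply is_lim_seq_mult'; try easy; apply is_lim_seq_const. }
    assert (H1 : eventually (fun j => pos_comb (fun n => aj j n * beta n) k N 1)).
    { apply (pos_comb_stable (fun j n => aj j n * beta n) (fun _ => k)
        (fun n => a n * beta n) k); [lra| | |easy].
      - intros n _. apply is_lim_seq_mult'; [apply Haj|apply is_lim_seq_const].
      - intros. apply is_lim_seq_const. }
    assert (H2 : eventually (fun j => sign_chain (sine_comb (aj j) k N) sg 0 b (S i))).
    { apply sign_chain_stable with (sine_comb a k N); [|easy].
      intros y. apply (is_lim_seq_sine_comb aj (fun _ => k));
        intros; [apply Haj|apply is_lim_seq_const]. }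
    destruct H1 as [j1 H1], H2 as [j2 H2]. set (j := (j1 + j2)%nat).
    assert (Hj1 := H1 j ltac:(lia)). assert (Hj2 := H2 j ltac:(lia)).
    set (t := tau j) in *.
    assert (Ht : 0 < t) by (apply Rinv_0_lt_compat, lt_0_INR; lia).
    assert (Hval : forall y, sine_comb (aj j) k N y =
      sine_comb a k N y + - sg * t * contact k m y).
    { intros y. unfold aj. rewrite sine_comb_lin, sine_comb_contact by lia. easy. }
    assert (Hle : forall y, 0 < y < b ->
      Rabs (sine_comb a k N y) <= C * (y^2 * contact k m y)).
    { intros y Hy. apply Rle_trans with (1 := Hbd y Hy).
      apply Rmult_le_compat_l; [lra|]. now apply (contact_succ_le k N Hpos Hinc b). }
    assert (Hcp : forall y, 0 < y < b -> 0 < contact k m y).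
    { intros y Hy. apply (contact_pos k N Hpos Hinc b m); try easy. lia. }
    assert (Hsg' : Rabs sg = 1).
    { assert (H := Rabs_mult sg sg). rewrite Hsg, Rabs_R1 in H.
      assert (0 <= Rabs sg) by apply Rabs_pos. nra. }
    (* The new constant adds the old bound, lowered by one order with [y^2 <= b^2], to the size [t]
       of the new term. *)
    exists (aj j), (- sg), (C * b^2 + t).
    split; [lra|]. split; [assert (0 < b^2) by (now apply pow_lt); nra|].
    split; [easy|]. split.
    + destruct (sign_chain_shrink _ _ _ _ _ Hj2) as [a' [Ha' Hsh]].
      (* The first two bounds keep [y] left of the old chain and inside the interval; the last two
         give [C * y^2 <= C * y <= t / 2], so the new term dominates at [y]. *)
      set (y := Rmin (Rmin (a' / 2) (b / 2)) (Rmin 1 (t / (2 * C)))).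
      assert (Hy0 : 0 < y) by (repeat apply Rmin_pos; try lra; apply Rdiv_lt_0_compat; lra).
      assert (Hya : y <= a' / 2) by (apply Rle_trans with (1 := Rmin_l _ _); apply Rmin_l).
      assert (Hyb : y <= b / 2) by (apply Rle_trans with (1 := Rmin_l _ _); apply Rmin_r).
      assert (Hy1 : y <= 1) by (apply Rle_trans with (1 := Rmin_r _ _); apply Rmin_l).
      assert (Hyt : y <= t / (2 * C)) by (apply Rle_trans with (1 := Rmin_r _ _); apply Rmin_r).
      exists y. split; [lra|]. split.
      * rewrite Hval. specialize (Hle y ltac:(lra)). specialize (Hcp y ltac:(lra)).
        assert (HyC : C * y^2 < t).
        { apply Rle_lt_trans with (C * y); [apply Rmult_le_compat_l; nra|].
          apply Rle_lt_trans with (C * (t / (2 * C))); [apply Rmult_le_compat_l; lra|].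
          replace (C * (t / (2 * C))) with (t / 2) by (field; lra). lra. }
        assert (Hab : - sg * sine_comb a k N y >= - Rabs (sine_comb a k N y)).
        { assert (H := Rle_abs (sg * sine_comb a k N y)).
          rewrite Rabs_mult, Hsg', Rmult_1_l in H. lra. }
        replace (- sg * (sine_comb a k N y + - sg * t * contact k m y)) with
          (- sg * sine_comb a k N y + sg * sg * (t * contact k m y)) by ring.
        rewrite Hsg. nra.
      * rewrite Ropp_involutive. apply Hsh. lra.
    + intros y Hy. rewrite Hval. fold m.
      apply Rle_trans with (1 := Rabs_triang _ _).
      rewrite !Rabs_mult, Rabs_Ropp, Hsg', (Rabs_right t), (Rabs_right (contact k m y));
        [|apply Rle_ge, Rlt_le, Hcp; easy|lra].
      specialize (Hle y Hy). specialize (Hcp y Hy).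
      assert (C * (y^2 * contact k m y) <= C * b^2 * contact k m y).
      { rewrite Rmult_assoc. apply Rmult_le_compat_l; [lra|].
        apply Rmult_le_compat_r; [lra|]. apply pow_incr. lra. }
      lra.
Qed.

(** * Incommensurable lengths *)

(** Infinite descent, with [n] bounding the size of [b]. *)
Lemma sqr_eq_double_sqr (n : nat) :
  forall a b : Z, (Z.abs b <= Z.of_nat n)%Z -> (a * a = 2 * (b * b))%Z -> b = 0%Z.
Proof.
  induction n as [|n IH]; intros a b Hb H; [lia|].
  destruct (Z.Even_or_Odd a) as [[c ->]|[c ->]]; [|nia].
  destruct (Z.Even_or_Odd b) as [[d ->]|[d ->]]; [|nia].
  assert (d = 0%Z) by (apply (IH c); [lia|nia]). lia.
Qed.

Lemma sqrt2_irrational (a b : Z) : IZR a = IZR b * sqrt 2 -> b = 0%Z.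
Proof.
  intros H. apply (sqr_eq_double_sqr (Z.abs_nat b) a); [lia|].
  apply eq_IZR. rewrite !mult_IZR, H.
  assert (H2 := sqrt_sqrt 2 ltac:(lra)).
  replace (IZR b * sqrt 2 * (IZR b * sqrt 2)) with (IZR b * IZR b * (sqrt 2 * sqrt 2)) by ring.
  rewrite H2. ring.
Qed.

(** A common zero of two of these sines would give an eigenfunction supported on two edges and
    vanishing at the centre. *)
Definition incommensurable (s : nat) (l : nat -> R) : Prop :=
  forall i j k, (i <= s)%nat -> (j <= s)%nat -> i <> j -> 0 < k ->
  sin (k * l i) = 0 -> sin (k * l j) <> 0.

(* Edge [0] has length 1 and the others are close to [1 / Q]; up to a common
   factor all lengths are [u + j sqrt 2] with integers [u], pairwise not
   proportional. *)
Definition perturbed_lengths (s Q i j : nat) : R :=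
  match j with
  | O => 1
  | S _ => / INR Q * (1 + INR j * (sqrt 2 / INR (i + S s)))
  end.

Lemma perturbed_incommensurable (s Q i : nat) :
  (0 < Q)%nat -> incommensurable s (perturbed_lengths s Q i).
Proof.
  intros HQ j1 j2 k _ _ Hne Hk H1 H2.
  set (D := (i + S s)%nat) in *.
  assert (HQ' : 0 < INR Q) by now apply lt_0_INR.
  assert (HD : 0 < INR D) by (apply lt_0_INR; unfold D; lia).
  set (u := fun j => match j with O => (Q * D)%nat | S _ => D end).
  assert (Hl : forall j, perturbed_lengths s Q i j =
    (INR (u j) + INR j * sqrt 2) / (INR Q * INR D)).
  { intros [|j]; unfold perturbed_lengths, u; fold D.
    - rewrite mult_INR. simpl. field. lra.
    - field. lra. }
  assert (Hlp : forall j, 0 < perturbed_lengths s Q i j).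
  { intros j. rewrite Hl. apply Rdiv_lt_0_compat; [|nra].
    assert (0 < INR (u j)) by (apply lt_0_INR; destruct j; simpl; unfold D; nia).
    assert (0 <= INR j * sqrt 2) by (apply Rmult_le_pos; [apply pos_INR|apply sqrt_pos]).
    lra. }
  assert (HPI := PI_RGT_0).
  apply sin_eq_0_0 in H1, H2. destruct H1 as [m1 H1], H2 as [m2 H2].
  assert (Hm1 : m1 <> 0%Z).
  { intros ->. assert (H := Rmult_lt_0_compat _ _ Hk (Hlp j1)). lra. }
  assert (Hm2 : m2 <> 0%Z).
  { intros ->. assert (H := Rmult_lt_0_compat _ _ Hk (Hlp j2)). lra. }
  assert (Hcross : perturbed_lengths s Q i j1 * IZR m2 = perturbed_lengths s Q i j2 * IZR m1).
  { apply Rmult_eq_reg_l with (k * PI); [|nra].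
    transitivity ((k * perturbed_lengths s Q i j1) * (IZR m2 * PI)); [ring|].
    rewrite H1, <- H2. ring. }
  rewrite !Hl in Hcross.
  assert (Hcross' : (INR (u j1) + INR j1 * sqrt 2) * IZR m2 =
    (INR (u j2) + INR j2 * sqrt 2) * IZR m1).
  { apply Rmult_eq_reg_r with (/ (INR Q * INR D)); [|apply Rinv_neq_0_compat; nra].
    unfold Rdiv in Hcross. lra. }
  rewrite !INR_IZR_INZ in Hcross'.
  (* Irrationality splits the relation into its sqrt 2 part, [j1 * m2 = j2 * m1], and its integer
     part, [u j1 * m2 = u j2 * m1]. *)
  assert (Hv := sqrt2_irrational
    (Z.of_nat (u j1) * m2 - Z.of_nat (u j2) * m1)
    (Z.of_nat j2 * m1 - Z.of_nat j1 * m2)).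
  rewrite !minus_IZR, !mult_IZR in Hv. specialize (Hv ltac:(lra)).
  assert (Hu : (Z.of_nat (u j1) * m2 = Z.of_nat (u j2) * m1)%Z).
  { apply eq_IZR. rewrite !mult_IZR.
    apply (f_equal IZR) in Hv. rewrite minus_IZR, !mult_IZR in Hv.
    replace ((IZR (Z.of_nat (u j1)) + IZR (Z.of_nat j1) * sqrt 2) * IZR m2) with
      (IZR (Z.of_nat (u j1)) * IZR m2 + (IZR (Z.of_nat j1) * IZR m2) * sqrt 2) in Hcross' by ring.
    replace (IZR (Z.of_nat j1) * IZR m2) with (IZR (Z.of_nat j2) * IZR m1) in Hcross' by lra.
    lra. }
  assert (HDZ : (0 < Z.of_nat D)%Z) by (unfold D; lia).
  (* If one index is 0, the sqrt 2 part makes a multiplier vanish; if both are positive, the integer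
     parts agree, so [m1 = m2] and the indices coincide. *)
  destruct j1 as [|j1], j2 as [|j2]; unfold u in Hu.
  - easy.
  - nia.
  - nia.
  - assert (m1 = m2) by nia. subst m2.
    assert (Z.of_nat (S j2) = Z.of_nat (S j1)) by nia. lia.
Qed.

Lemma sqrt2_lt_2 : sqrt 2 < 2.
Proof.
  assert (H := sqrt_sqrt 2 ltac:(lra)). assert (H0 := sqrt_pos 2). nra.
Qed.

Lemma perturbed_admissible (s M Q i : nat) :
  (0 < Q)%nat -> / INR Q * INR M <= 1 / 4 -> admissible s M (perturbed_lengths s Q i).
Proof.
  intros HQ HM. split; [easy|]. intros [|j] Hj; [lia|]. unfold perturbed_lengths.
  set (D := (i + S s)%nat). set (e := / INR Q) in *.
  assert (HQ' : 0 < e) by (apply Rinv_0_lt_compat; now apply lt_0_INR).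
  assert (HD : 0 < INR D) by (apply lt_0_INR; unfold D; lia).
  (* The offset [S s] in the denominator keeps every short edge below three times [e]. *)
  assert (HjD : INR (S j) <= INR D) by (apply le_INR; unfold D; lia).
  assert (Hj0 : 0 < INR (S j)) by (apply lt_0_INR; lia).
  assert (H2 := sqrt2_lt_2). assert (H2' : 0 < sqrt 2) by (apply sqrt_lt_R0; lra).
  assert (Hd : 0 < INR (S j) * (sqrt 2 / INR D) < 2).
  { split.
    - apply Rmult_lt_0_compat; [easy|]. now apply Rdiv_lt_0_compat.
    - apply Rle_lt_trans with (INR D * (sqrt 2 / INR D)).
      + apply Rmult_le_compat_r; [|easy]. now apply Rlt_le, Rdiv_lt_0_compat.
      + replace (INR D * (sqrt 2 / INR D)) with (sqrt 2) by (field; lra). easy. }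
  split; [apply Rmult_lt_0_compat; lra|].
  assert (HM0 := pos_INR M).
  replace (e * (1 + INR (S j) * (sqrt 2 / INR D)) * INR M) with
    (e * INR M * (1 + INR (S j) * (sqrt 2 / INR D))) by ring.
  assert (0 <= e * INR M) by nra. nra.
Qed.

(** * A generic graph with the required sign changes *)

(** [c] holds the coefficients relative to eigenfunctions equal to 1 at the centre; arguments are
    distances to the leaf, so [z = 1] on edge 0 is the centre. *)
Definition many_zeros (s : nat) (l : nat -> R) (N : nat) : Prop :=
  exists c : nat -> R,
    (forall z, 0 < z <= 1 ->
       0 < sine_comb (fun n => c n / sin (freq s l n * l 0%nat)) (freq s l) N z) /\
    forall j, (1 <= j <= s)%nat -> exists sg,
       sign_chain (sine_comb (fun n => c n / sin (freq s l n * l j)) (freq s l) N)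
         sg 0 (l j) (S N).

Lemma many_zeros_lengths_exist (s M : nat) : (0 < s)%nat -> (0 < M)%nat ->
  exists l, admissible s M l /\ incommensurable s l /\
    forall N, (N < M)%nat -> many_zeros s l N.
Proof.
  intros Hs HM.
  destruct (equal_long_edge_pos s M Hs HM) as [i0 Hlong]. cbv zeta in Hlong.
  destruct (inv_seq_facts M i0 HM) as [He HeM].
  set (Q := (i0 + S (4 * M))%nat). change (inv_seq M i0) with (/ INR Q) in *.
  assert (HQ : (0 < Q)%nat) by (unfold Q; lia).
  set (e := / INR Q) in *. set (le := equal_lengths e) in *. set (k := freq s le) in *.
  assert (Hle : admissible s M le) by (apply equal_admissible; lra).
  set (li := perturbed_lengths s Q).
  assert (Hli : forall i, admissible s M (li i)) by (intros; now apply perturbed_admissible).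
  assert (Hlim : forall j, is_lim_seq (fun i => li i j) (le j)).
  { intros [|j]; [apply is_lim_seq_const|]. unfold li, perturbed_lengths, le, equal_lengths.
    fold e. replace e with (e * (1 + INR (S j) * (sqrt 2 * 0))) at 1 by ring.
    apply is_lim_seq_mult'; [apply is_lim_seq_const|].
    apply is_lim_seq_plus'; [apply is_lim_seq_const|].
    apply is_lim_seq_mult'; [apply is_lim_seq_const|].
    apply is_lim_seq_mult'; [apply is_lim_seq_const|apply is_lim_seq_inv_nat]. }
  set (ki := fun i => freq s (li i)).
  assert (Hki : forall n, (n < M)%nat -> is_lim_seq (fun i => ki i n) (k n))
    by (intros; now apply freq_continuous with M).
  assert (Hev : eventually (fun i => forall N, (N < M)%nat -> many_zeros s (li i) N)).
  { apply eventually_bounded_forall. intros N HN.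
    assert (Hkp : forall n, (n <= N)%nat -> 0 < k n)
      by (intros; apply freq_pos with M; [easy|lia]).
    assert (Hkinc : forall m n, (m < n)%nat -> (n <= N)%nat -> k m < k n)
      by (intros; apply freq_increasing with M; [easy|easy|lia]).
    assert (Hke : k N * e <= PI / 2).
    { assert (H := freq_lt_PI_mul s M le N e Hle HN He). fold k in H.
      assert (HPI := PI_RGT_0). nra. }
    destruct (sign_pattern k (fun n => sin (k n * e) / sin (k n)) N e
      Hkp Hkinc He Hke (Hlong N HN) N (le_n _)) as [a [sg [_ [_ [_ [Hp [Hch _]]]]]]].
    (* Makes the short-edge coefficient [c n / sin (k n * e)] equal to [a n] at equal lengths. From
       here [c] is fixed and only the lengths move. *)
    set (c := fun n => a n * sin (k n * e)).
    assert (Hlc : forall j n, (j <= s)%nat -> (n <= N)%nat ->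
      is_lim_seq (fun i => c n / sin (ki i n * li i j)) (c n / sin (k n * le j))).
    { intros j n Hj Hn. apply is_lim_seq_div'; [apply is_lim_seq_const| |].
      - apply (is_lim_seq_continuous sin); [apply continuity_sin|].
        apply is_lim_seq_mult'; [apply Hki; lia|apply Hlim].
      - apply (sin_freq_neq_0 s M); [easy|lia|easy]. }
    assert (H1 : eventually (fun i =>
      pos_comb (fun n => c n / sin (ki i n * li i 0%nat)) (ki i) N 1)).
    { apply (pos_comb_stable (fun i n => c n / sin (ki i n * li i 0%nat)) ki
        (fun n => c n / sin (k n * le 0%nat)) k); [lra| | |].
      - intros; apply Hlc; [lia|easy].
      - intros; apply Hki; lia.
      - destruct Hp as [HD Hp]. unfold c. simpl le. split.
        + replace (sum_f_R0 _ N) with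
            (sum_f_R0 (fun n => a n * (sin (k n * e) / sin (k n)) * k n) N); [easy|].
          apply sum_eq. intros n Hn. rewrite Rmult_1_r. unfold Rdiv. ring.
        + intros z Hz. rewrite (sine_comb_ext _ (fun n => a n * (sin (k n * e) / sin (k n)))
            k k N z); [now apply Hp| |easy].
          intros n Hn. rewrite Rmult_1_r. unfold Rdiv. ring. }
    assert (H2 : eventually (fun i => forall j, (j < s)%nat ->
      sign_chain (sine_comb (fun n => c n / sin (ki i n * li i (S j))) (ki i) N) sg 0 e (S N))).
    { apply eventually_bounded_forall. intros j Hj.
      apply (sign_chain_stable (fun i => sine_comb (fun n => c n / sin (ki i n * li i (S j))) (ki i) N)
        (sine_comb a k N)); [|easy].
      intros y.
      apply (is_lim_seq_sine_comb (fun i n => c n / sin (ki i n * li i (S j))) ki).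
      - intros n Hn.
        replace (a n) with (c n / sin (k n * le (S j))).
        + apply Hlc; [lia|easy].
        + unfold c. simpl le. field.
          apply (sin_freq_neq_0 s M le n 1); [easy|lia|lia].
      - intros n Hn. apply Hki. lia. }
    generalize (filter_and _ _ H1 H2). apply filter_imp. intros i [[_ Hi1] Hi2].
    exists c. split; [exact Hi1|]. intros [|j] Hj; [lia|]. exists sg.
    (* The perturbation only lengthens the short edges, so the chain on [(0, e)] still fits. *)
    apply sign_chain_weaken with e; [|apply Hi2; lia].
    unfold li, perturbed_lengths. fold e.
    assert (0 <= INR (S j) * (sqrt 2 / INR (i + S s))).
    { apply Rmult_le_pos; [apply pos_INR|]. apply Rmult_le_pos; [apply sqrt_pos|].
      apply Rlt_le, Rinv_0_lt_compat, lt_0_INR. lia. }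
    nra. }
  destruct Hev as [i Hi]. exists (li i). split; [easy|]. split.
  - now apply perturbed_incommensurable.
  - now apply (Hi i).
Qed.

(** * The spectrum *)

(** [up] is strictly above its argument, so this is the first pole of edge [j] strictly beyond
    [p]. *)
Definition edge_pole (l : nat -> R) (p : R) (j : nat) : R :=
  IZR (up (p * l j / PI)) * PI / l j.

Fixpoint next_pole (l : nat -> R) (p : R) (s : nat) : R :=
  match s with
  | O => edge_pole l p 0
  | S s' => Rmin (next_pole l p s') (edge_pole l p (S s'))
  end.

(** All nonnegative poles in increasing order, a pole shared by several edges being listed once. *)
Fixpoint poles (s : nat) (l : nat -> R) (n : nat) : R :=
  match n with
  | O => 0
  | S n' => next_pole l (poles s l n') s
  end.

Lemma next_pole_le (l : nat -> R) (p : R) (s j : nat) :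
  (j <= s)%nat -> next_pole l p s <= edge_pole l p j.
Proof.
  induction s as [|s IH]; intros Hj; simpl.
  - replace j with 0%nat by lia. lra.
  - destruct (Nat.eq_dec j (S s)) as [->|]; [apply Rmin_r|].
    apply Rle_trans with (1 := Rmin_l _ _). apply IH. lia.
Qed.

Lemma next_pole_attained (l : nat -> R) (p : R) (s : nat) :
  exists j, (j <= s)%nat /\ next_pole l p s = edge_pole l p j.
Proof.
  induction s as [|s [j [Hj IH]]]; simpl; [now exists 0%nat|].
  unfold Rmin. destruct (Rle_dec _ _).
  - exists j. split; [lia|easy].
  - now exists (S s).
Qed.

Lemma edge_pole_gt (l : nat -> R) (p : R) (j : nat) : 0 < l j -> p < edge_pole l p j.
Proof.
  intros Hl. unfold edge_pole. destruct (archimed (p * l j / PI)) as [H _].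
  assert (HPI := PI_RGT_0). apply Rmult_lt_reg_r with (l j / PI).
  - now apply Rdiv_lt_0_compat.
  - replace (IZR (up (p * l j / PI)) * PI / l j * (l j / PI)) with
      (IZR (up (p * l j / PI))) by (field; lra).
    replace (p * (l j / PI)) with (p * l j / PI) by (unfold Rdiv; ring). easy.
Qed.

Lemma edge_pole_free (l : nat -> R) (p k : R) (j : nat) :
  0 < l j -> p < k < edge_pole l p j -> sin (k * l j) <> 0.
Proof.
  intros Hl Hk H0. apply sin_eq_0_0 in H0. destruct H0 as [z Hz].
  assert (HPI := PI_RGT_0). unfold edge_pole in Hk.
  set (r := p * l j / PI) in *. destruct (archimed r) as [H1 H2].
  assert (Hkz : k = IZR z * PI / l j).
  { apply Rmult_eq_reg_r with (l j); [|lra]. rewrite Hz. field. lra. }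
  assert (Hlo : r < IZR z).
  { replace (IZR z) with (k * (l j / PI)) by (rewrite Hkz; field; lra).
    unfold r. replace (p * l j / PI) with (p * (l j / PI)) by (unfold Rdiv; ring).
    apply Rmult_lt_compat_r; [now apply Rdiv_lt_0_compat|easy]. }
  assert (Hhi : IZR z < IZR (up r)).
  { apply Rmult_lt_reg_r with (PI / l j); [now apply Rdiv_lt_0_compat|].
    rewrite Hkz in Hk. unfold Rdiv in *. lra. }
  assert (Hlo' : IZR (up r - 1) < IZR z) by (rewrite minus_IZR; lra).
  apply lt_IZR in Hhi, Hlo'. lia.
Qed.

Section Poles.

Variables (s : nat) (l : nat -> R).
Hypothesis Hl : forall j, (j <= s)%nat -> 0 < l j.

Lemma poles_increasing (n : nat) : poles s l n < poles s l (S n).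
Proof.
  simpl. destruct (next_pole_attained l (poles s l n) s) as [j [Hj ->]].
  now apply edge_pole_gt, Hl.
Qed.

Lemma poles_lt (m n : nat) : (m < n)%nat -> poles s l m < poles s l n.
Proof.
  induction 1 as [|n _ IH]; [apply poles_increasing|].
  apply Rlt_trans with (1 := IH), poles_increasing.
Qed.

Lemma poles_nonneg (n : nat) : 0 <= poles s l n.
Proof.
  destruct n as [|n]; [simpl; lra|]. apply Rlt_le, (poles_lt 0). lia.
Qed.

Lemma poles_pole_free (n : nat) : pole_free s l (poles s l n) (poles s l (S n)).
Proof.
  intros j k Hj [H1 H2]. apply edge_pole_free with (poles s l n); [now apply Hl|].
  split; [easy|]. apply Rlt_le_trans with (1 := H2). now apply next_pole_le.
Qed.

Lemma poles_sin (n : nat) : exists j, (j <= s)%nat /\ sin (poles s l n * l j) = 0.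
Proof.
  destruct n as [|n].
  - exists 0%nat. split; [lia|]. simpl. now rewrite Rmult_0_l, sin_0.
  - simpl. destruct (next_pole_attained l (poles s l n) s) as [j [Hj ->]].
    exists j. split; [easy|]. apply sin_eq_0_1.
    exists (up (poles s l n * l j / PI)). unfold edge_pole. field. apply Rgt_not_eq, Hl, Hj.
Qed.

(* The number of multiples of [PI / l j] in [[0, p]], summed over the edges,
   grows by at least one at each step of [poles] and linearly in [p]. *)
Lemma poles_lower (n : nat) :
  INR n <= sum_f_R0 (fun j => IZR (up (poles s l n * l j / PI))) s.
Proof.
  induction n as [|n IH].
  - simpl. apply sum_f_R0_nonneg. intros j Hj.
    rewrite Rmult_0_l. unfold Rdiv. rewrite Rmult_0_l.
    destruct (archimed 0). lra.
  - rewrite S_INR.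
    destruct (next_pole_attained l (poles s l n) s) as [i [Hi Hp]].
    assert (HPI := PI_RGT_0).
    assert (Hup : forall x y, x <= y -> (up x <= up y)%Z).
    { intros x y Hxy. destruct (archimed x) as [_ Hx], (archimed y) as [Hy _].
      assert (IZR (up x - 1) < IZR (up y)) by (rewrite minus_IZR; lra).
      apply lt_IZR in H. lia. }
    assert (Hstep : 1 <= sum_f_R0 (fun j => IZR (up (poles s l (S n) * l j / PI))
       - IZR (up (poles s l n * l j / PI))) s).
    { apply Rle_trans with (IZR (up (poles s l (S n) * l i / PI))
        - IZR (up (poles s l n * l i / PI))).
      - set (r := up (poles s l n * l i / PI)).
        replace (poles s l (S n) * l i / PI) with (IZR r).
        + destruct (archimed (IZR r)) as [H _]. apply lt_IZR in H.
          rewrite <- minus_IZR. apply IZR_le. lia.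
        + simpl. rewrite Hp. unfold edge_pole, r. field.
          assert (H := Hl i Hi). lra.
      - apply (sum_f_R0_ge_term (fun j => IZR (up (poles s l (S n) * l j / PI))
          - IZR (up (poles s l n * l j / PI)))); [|easy].
        intros j Hj. assert (H := Hl j Hj). apply Rge_le, Rge_minus, Rle_ge, IZR_le, Hup.
        apply Rmult_le_compat_r; [now apply Rlt_le, Rinv_0_lt_compat|].
        apply Rmult_le_compat_r; [lra|]. apply Rlt_le, poles_increasing. }
    rewrite minus_sum in Hstep. lra.
Qed.

Lemma poles_unbounded (k : R) : exists n, k < poles s l n.
Proof.
  set (A := sum_f_R0 (fun j => l j / PI) s).
  assert (HPI := PI_RGT_0).
  assert (HA : 0 <= A).
  { apply sum_f_R0_nonneg. intros j Hj. assert (H := Hl j Hj).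
    now apply Rlt_le, Rdiv_lt_0_compat. }
  (* If [poles s l n] were at most [k], the count in [poles_lower] would be at most [A * k] plus 1
     for each of the [S s] edges. *)
  destruct (INR_unbounded (A * k + INR (S s))) as [n Hn]. exists n.
  apply Rnot_le_lt. intros Hk.
  assert (H : sum_f_R0 (fun j => IZR (up (poles s l n * l j / PI))) s
    <= sum_f_R0 (fun j => l j / PI * poles s l n + 1) s).
  { apply sum_Rle. intros j _. destruct (archimed (poles s l n * l j / PI)) as [_ H].
    replace (l j / PI * poles s l n) with (poles s l n * l j / PI) by (unfold Rdiv; ring).
    lra. }
  rewrite plus_sum, <- (scal_sum _ _ (poles s l n)), sum_cte in H. fold A in H.
  assert (H' := poles_lower n). nra.
Qed.

Lemma poles_cover (k : R) :
  0 < k -> (forall j, (j <= s)%nat -> sin (k * l j) <> 0) ->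
  exists n, poles s l n < k < poles s l (S n).
Proof.
  intros Hk Hs. destruct (poles_unbounded k) as [m Hm].
  induction m as [|m IH]; [simpl in Hm; lra|].
  destruct (Rtotal_order k (poles s l m)) as [H|[H|H]].
  - now apply IH.
  - exfalso. destruct (poles_sin m) as [j [Hj Hj']]. apply (Hs j Hj). now rewrite H.
  - now exists m.
Qed.

Definition spec_freq (n : nat) : R := cot_root s l (poles s l n) (poles s l (S n)).

Lemma spec_freq_spec (n : nat) :
  poles s l n < spec_freq n < poles s l (S n) /\ cot_sum s l (spec_freq n) = 0.
Proof.
  apply cot_root_spec.
  - exact Hl.
  - apply poles_pole_free.
  - apply poles_increasing.
  - apply poles_sin.
  - apply poles_sin.
Qed.

Lemma spec_freq_pos (n : nat) : 0 < spec_freq n.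
Proof.
  destruct (spec_freq_spec n) as [H _]. assert (H' := poles_nonneg n). lra.
Qed.

Lemma spec_freq_lt (m n : nat) : (m < n)%nat -> spec_freq m < spec_freq n.
Proof.
  intros Hmn. destruct (spec_freq_spec n) as [H _], (spec_freq_spec m) as [H' _].
  destruct (Nat.eq_dec (S m) n) as [<-|Hne]; [lra|].
  assert (H2 := poles_lt (S m) n ltac:(lia)). lra.
Qed.

Lemma spec_freq_sin (n j : nat) : (j <= s)%nat -> sin (spec_freq n * l j) <> 0.
Proof.
  intros Hj. apply (poles_pole_free n j); [easy|]. apply spec_freq_spec.
Qed.

Lemma spec_freq_surj (k : R) :
  0 < k -> (forall j, (j <= s)%nat -> sin (k * l j) <> 0) -> cot_sum s l k = 0 ->
  exists n, k = spec_freq n.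
Proof.
  intros Hk Hs H0. destruct (poles_cover k Hk Hs) as [n Hn]. exists n.
  destruct (spec_freq_spec n) as [H1 H2].
  now apply (cot_sum_root_unique s l (poles s l n) (poles s l (S n)));
    [|apply poles_pole_free| | | |].
Qed.

Lemma admissible_poles (M n : nat) : admissible s M l -> (n <= M)%nat -> poles s l n = INR n * PI.
Proof.
  intros [H0 HM]. assert (HPI := PI_RGT_0). induction n as [|n IH]; intros Hn.
  - simpl. ring.
  - simpl poles. rewrite IH by lia.
    assert (HE : edge_pole l (INR n * PI) 0 = INR (S n) * PI).
    { unfold edge_pole. rewrite H0, !Rmult_1_r.
      replace (INR n * PI / PI) with (INR n) by (field; lra).
      rewrite INR_IZR_INZ. rewrite <- (tech_up _ (Z.of_nat n + 1)).
      - rewrite plus_IZR, <- INR_IZR_INZ, S_INR. field.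
      - rewrite plus_IZR. lra.
      - rewrite plus_IZR. lra. }
    apply Rle_antisym.
    + rewrite <- HE. apply next_pole_le. lia.
    + destruct (next_pole_attained l (INR n * PI) s) as [[|j] [Hj ->]]; [rewrite HE; lra|].
      destruct (HM (S j)) as [Hlj Hlj']; [lia|].
      unfold edge_pole. set (r := INR n * PI * l (S j) / PI).
      assert (Hr : 0 <= r).
      { unfold r. replace (INR n * PI * l (S j) / PI) with (INR n * l (S j)) by (field; lra).
        apply Rmult_le_pos; [apply pos_INR|lra]. }
      assert (Hup : 1 <= IZR (up r)).
      { apply IZR_le. destruct (archimed r) as [H _].
        assert (0 < IZR (up r)) by lra. apply lt_IZR in H1. lia. }
      apply Rmult_le_reg_r with (l (S j)); [easy|].
      replace (IZR (up r) * PI / l (S j) * l (S j)) with (IZR (up r) * PI) by (field; lra).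
      apply Rle_trans with (1 * PI); [|apply Rmult_le_compat_r; lra].
      assert (INR (S n) * l (S j) <= INR M * l (S j)).
      { apply Rmult_le_compat_r; [lra|]. now apply le_INR. }
      nra.
Qed.

(** Links the construction to the spectrum: its first [M] frequencies are the lowest ones of the
    graph, none being skipped. *)
Lemma spec_freq_eq_freq (M n : nat) : admissible s M l -> (n < M)%nat -> spec_freq n = freq s l n.
Proof.
  intros Ha Hn. unfold spec_freq, freq. now rewrite !(admissible_poles M) by (easy || lia).
Qed.

(** * Eigenfunctions, completeness and genericity *)

Definition eigenfun (n j : nat) (x : R) : R :=
  sin (spec_freq n * (l j - x)) / sin (spec_freq n * l j).

Lemma eigenfun_0 (n j : nat) : (j <= s)%nat -> eigenfun n j 0 = 1.
Proof.
  intros Hj. unfold eigenfun. rewrite Rminus_0_r. field. now apply spec_freq_sin.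
Qed.

Lemma is_derive_eigenfun (n j : nat) (x : R) :
  is_derive (eigenfun n j) x
    (- spec_freq n * cos (spec_freq n * (l j - x)) / sin (spec_freq n * l j)).
Proof.
  unfold eigenfun. auto_derive; [easy|]. unfold Rdiv, Rminus. ring.
Qed.

Lemma is_derive_eigenfun' (n j : nat) (x : R) :
  is_derive (fun x => - spec_freq n * cos (spec_freq n * (l j - x)) / sin (spec_freq n * l j))
    x (- (spec_freq n)^2 * eigenfun n j x).
Proof.
  unfold eigenfun. auto_derive; [easy|]. unfold Rdiv, Rminus. ring.
Qed.

Lemma eigenfun_is_eigenfunction (n : nat) :
  is_eigenfunction s l ((spec_freq n)^2) (eigenfun n).
Proof.
  split; [|split; [|split; [|split]]].
  - intros j Hj. exists
      (fun x => - spec_freq n * cos (spec_freq n * (l j - x)) / sin (spec_freq n * l j)),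
      (fun x => - (spec_freq n)^2 * eigenfun n j x).
    intros x. split; [apply is_derive_eigenfun|].
    split; [apply is_derive_eigenfun'|]. ring.
  - intros j Hj. unfold eigenfun. rewrite Rminus_diag, Rmult_0_r, sin_0. apply Rmult_0_l.
  - intros i j Hi Hj. now rewrite !eigenfun_0.
  - destruct (spec_freq_spec n) as [_ H0].
    transitivity (- spec_freq n * cot_sum s l (spec_freq n)); [|rewrite H0; ring].
    unfold cot_sum. rewrite scal_sum. apply sum_eq. intros j Hj.
    rewrite (is_derive_unique _ _ _ (is_derive_eigenfun n j 0)), Rminus_0_r.
    unfold Rdiv. ring.
  - exists 0%nat, 0. split; [lia|]. split; [split; [lra|apply Rlt_le, Hl; lia]|].
    rewrite eigenfun_0 by lia. lra.
Qed.

(** The Wronskian divided by [b^2 - a^2] is a primitive of the product. Each edge thus contributes a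
    difference of cotangent terms at the centre, and these sum to zero by the two secular
    equations. *)
Lemma eigenfun_orthogonal (m n : nat) : m <> n ->
  l2_inner s l (eigenfun m) (eigenfun n) = 0.
Proof.
  intros Hmn. set (a := spec_freq m). set (b := spec_freq n).
  assert (Ha : 0 < a) by apply spec_freq_pos. assert (Hb : 0 < b) by apply spec_freq_pos.
  assert (Hab : b^2 - a^2 <> 0).
  { assert (a <> b).
    { destruct (Nat.lt_total m n) as [H|[H|H]]; [|easy|];
        assert (H' := spec_freq_lt _ _ H); unfold a, b; lra. }
    intros H0. assert ((b - a) * (b + a) = 0) by nra.
    apply Rmult_integral in H1. destruct H1; lra. }
  assert (Hj : forall j, (j <= s)%nat ->
    RInt (fun x => eigenfun m j x * eigenfun n j x) 0 (l j) =
    (a * (cos (a * l j) / sin (a * l j)) - b * (cos (b * l j) / sin (b * l j))) * / (b^2 - a^2)).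
  { intros j Hj.
    set (da := fun x => - a * cos (a * (l j - x)) / sin (a * l j)).
    set (db := fun x => - b * cos (b * (l j - x)) / sin (b * l j)).
    set (F := fun x => / (b^2 - a^2) * (da x * eigenfun n j x - eigenfun m j x * db x)).
    assert (HF : forall x, is_derive F x (eigenfun m j x * eigenfun n j x)).
    { intros x. evar_last.
      - apply is_derive_scal.
        apply (is_derive_minus (fun x => da x * eigenfun n j x) (fun x => eigenfun m j x * db x)).
        + apply (is_derive_mult da (eigenfun n j));
            [apply is_derive_eigenfun'|apply is_derive_eigenfun|intros; apply Rmult_comm].
        + apply (is_derive_mult (eigenfun m j) db);
            [apply is_derive_eigenfun|apply is_derive_eigenfun'|intros; apply Rmult_comm].
      - unfold minus, plus, opp, mult; simpl. unfold mult, da, db; simpl. fold a b.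
        assert (sin (a * l j) <> 0) by now apply spec_freq_sin.
        assert (sin (b * l j) <> 0) by now apply spec_freq_sin.
        field. repeat split; try easy. simpl in Hab. lra. }
    assert (HI : is_RInt (fun x => eigenfun m j x * eigenfun n j x) 0 (l j) (F (l j) - F 0)).
    { apply (is_RInt_derive F).
      - intros x _. apply HF.
      - intros x _. apply (ex_derive_continuous (fun x => eigenfun m j x * eigenfun n j x)).
        eexists. apply (is_derive_mult (eigenfun m j) (eigenfun n j));
          [apply is_derive_eigenfun|apply is_derive_eigenfun|intros; apply Rmult_comm]. }
    apply (eq_trans (is_RInt_unique _ _ _ _ HI)).
    match goal with |- ?u = ?v => change (@eq R u v) end. unfold F.
    rewrite !eigenfun_0 by easy. unfold eigenfun.
    rewrite !Rminus_diag, !Rmult_0_r, sin_0. unfold da, db. rewrite !Rminus_0_r.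
    unfold Rdiv. ring. }
  destruct (spec_freq_spec m) as [_ H1], (spec_freq_spec n) as [_ H2].
  fold a in H1. fold b in H2.
  transitivity (/ (b^2 - a^2) * (a * cot_sum s l a - b * cot_sum s l b)).
  - unfold l2_inner. rewrite (sum_eq _ _ _ Hj). unfold cot_sum.
    rewrite (scal_sum _ s a), (scal_sum _ s b), <- minus_sum, scal_sum.
    apply sum_eq. intros. ring.
  - rewrite H1, H2. ring.
Qed.

(** The product [u * u'] has derivative [u'^2 - lam u^2 >= 0] and vanishes at [L]. If it also
    vanishes at 0, it vanishes in between, so [u^2] is constant and equal to its value 0 at [L]. *)
Lemma nonpositive_energy (u du : R -> R) (lam L : R) :
  0 < L -> lam <= 0 -> u L = 0 ->
  (forall x, is_derive u x (du x)) -> (forall x, is_derive du x (- (lam * u x))) ->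
  u 0 * du 0 <= 0 /\ (u 0 * du 0 = 0 -> forall x, 0 <= x <= L -> u x = 0).
Proof.
  intros HL Hlam HuL Hu Hdu.
  set (w := fun x => u x * du x).
  assert (Hw : forall x, is_derive w x (du x * du x + - lam * (u x * u x))).
  { intros x. evar_last.
    - apply (is_derive_mult u du); [apply Hu|apply Hdu|intros; apply Rmult_comm].
    - unfold plus, mult; simpl. unfold mult; simpl. ring. }
  assert (Hmono : forall x y, x <= y -> w x <= w y).
  { intros x y Hxy. destruct (Req_dec x y) as [->|Hne]; [lra|].
    destruct (mvt w _ x y ltac:(lra) (fun x _ => Hw x)) as [c [Hc Hd]].
    assert (0 <= du c * du c) by apply Rle_0_sqr.
    assert (0 <= - lam * (u c * u c)) by (apply Rmult_le_pos; [lra|apply Rle_0_sqr]).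
    nra. }
  assert (HwL : w L = 0) by (unfold w; rewrite HuL; ring).
  split; [change (w 0 <= 0); rewrite <- HwL; apply Hmono; lra|].
  intros Hw0 x Hx. change (w 0 = 0) in Hw0.
  destruct (Req_dec x L) as [->|Hne]; [easy|].
  destruct (mvt (fun x => u x * u x) (fun x => 2 * w x) x L) as [c [Hc Hd]]; [lra| |].
  - intros t _. evar_last.
    + apply (is_derive_mult u u); [apply Hu|apply Hu|intros; apply Rmult_comm].
    + unfold plus, mult; simpl. unfold mult, w; simpl. ring.
  - assert (H1 := Hmono 0 c ltac:(lra)). assert (H2 := Hmono c L ltac:(lra)).
    rewrite HuL in Hd. nra.
Qed.

(** Multiplying the Kirchhoff condition by the common central value gives a vanishing sum of the
    terms [f * f'] at 0. For [lam <= 0] all are nonpositive, hence zero, and [f] vanishes. *)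
Lemma eigenvalue_pos (lam : R) (f : graph_fun) : is_eigenfunction s l lam f -> 0 < lam.
Proof.
  intros [Hode [Hdir [Hcont [Hkir [j [x [Hj [Hx Hne]]]]]]]].
  apply Rnot_le_lt. intros Hlam.
  assert (He : forall i, (i <= s)%nat -> f i 0 * Derive (f i) 0 <= 0 /\
    (f i 0 * Derive (f i) 0 = 0 -> forall x, 0 <= x <= l i -> f i x = 0)).
  { intros i Hi. destruct (Hode i Hi) as [f1 [f2 H]].
    rewrite (is_derive_unique _ _ _ (proj1 (H 0))).
    apply (nonpositive_energy (f i) f1 lam); try easy.
    - now apply Hl.
    - now apply Hdir.
    - intros t. apply H.
    - intros t. destruct (H t) as [_ [H1 H2]].
      replace (- (lam * f i t)) with (f2 t) by lra. easy. }
  apply Hne. apply (He j Hj); [|easy].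
  assert (Hsum : sum_f_R0 (fun i => f i 0 * Derive (f i) 0) s = 0).
  { transitivity (f 0%nat 0 * sum_f_R0 (fun i => Derive (f i) 0) s); [|rewrite Hkir; ring].
    rewrite scal_sum. apply sum_eq. intros i Hi.
    rewrite (Hcont i 0%nat Hi (Nat.le_0_l _)). ring. }
  assert (H := sum_f_R0_ge_term (fun i => f i 0 * Derive (f i) 0 * -(1)) s j).
  rewrite <- scal_sum, Hsum in H.
  specialize (H ltac:(intros i Hi; specialize (He i Hi); lra) Hj).
  specialize (He j Hj). lra.
Qed.

Lemma eigenfunction_form (lam : R) (f : graph_fun) : is_eigenfunction s l lam f ->
  exists (k : R) (B : nat -> R), 0 < k /\ lam = k^2 /\
    (forall j x, (j <= s)%nat -> f j x = B j * sin (k * (l j - x))) /\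
    sum_f_R0 (fun j => B j * cos (k * l j)) s = 0.
Proof.
  intros Hf. assert (Hlam := eigenvalue_pos lam f Hf).
  destruct Hf as [Hode [Hdir [_ [Hkir _]]]].
  set (k := sqrt lam). assert (Hk : 0 < k) by now apply sqrt_lt_R0.
  assert (Hk2 : lam = k^2) by (unfold k; simpl; rewrite Rmult_1_r, sqrt_sqrt; lra).
  set (B := fun j => - Derive (f j) (l j) / k).
  assert (Hform : forall j x, (j <= s)%nat -> f j x = B j * sin (k * (l j - x))).
  { intros j x Hj. destruct (Hode j Hj) as [f1 [f2 H]].
    apply Rminus_diag_uniq.
    apply (oscillator_unique (fun x => f j x - B j * sin (k * (l j - x)))
      (fun x => f1 x - B j * (- k * cos (k * (l j - x)))) k (l j)).
    - lra.
    - rewrite Hdir, Rminus_diag, Rmult_0_r, sin_0 by easy. ring.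
    - rewrite Rminus_diag, Rmult_0_r, cos_0. unfold B.
      rewrite (is_derive_unique _ _ _ (proj1 (H (l j)))). field. lra.
    - intros y. apply (is_derive_minus (f j) (fun x => B j * sin (k * (l j - x)))); [apply H|].
      auto_derive; [easy|]. unfold Rminus. ring.
    - intros y. evar_last.
      + apply (is_derive_minus f1 (fun x => B j * (- k * cos (k * (l j - x)))));
          [apply H|auto_derive; [easy|reflexivity]].
      + destruct (H y) as [_ [_ H2]]. unfold minus, plus, opp; simpl.
        replace (f2 y) with (- k^2 * f j y) by (rewrite Hk2 in H2; lra).
        unfold Rminus. ring. }
  exists k, B. repeat split; try easy.
  apply Rmult_eq_reg_l with (- k); [|lra]. rewrite Rmult_0_r, <- Hkir, scal_sum.
  apply sum_eq. intros j Hj. symmetry.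
  rewrite (Derive_ext (f j) (fun x => B j * sin (k * (l j - x))) 0)
    by (intros; now apply Hform).
  apply is_derive_unique. auto_derive; [easy|]. rewrite Ropp_0, Rplus_0_r. ring.
Qed.

(** If the central value is 0, each edge has zero amplitude or [sin (k * l i) = 0]; the latter
    occurs on a single edge, where the Kirchhoff condition then forces the cosine to vanish as
    well. *)
Lemma zero_generic_of_incommensurable : incommensurable s l -> zero_generic s l.
Proof.
  intros Hinc lam f Hf H0.
  destruct (eigenfunction_form lam f Hf) as [k [B [Hk [_ [Hform Hkir]]]]].
  destruct Hf as [_ [_ [Hcont [_ [j [x [Hj [_ Hne]]]]]]]].
  assert (Hzero : forall i, (i <= s)%nat -> B i * sin (k * l i) = 0).
  { intros i Hi. rewrite <- H0, (Hcont 0%nat i (Nat.le_0_l _) Hi), Hform by easy.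
    now rewrite Rminus_0_r. }
  assert (HB : B j <> 0).
  { intros HB. apply Hne. rewrite Hform, HB by easy. ring. }
  assert (Hsj : sin (k * l j) = 0).
  { destruct (Rmult_integral _ _ (Hzero j Hj)); easy. }
  rewrite (sum_f_R0_single _ s j Hj) in Hkir.
  - apply Rmult_integral in Hkir. destruct Hkir as [|Hc]; [easy|].
    assert (H := sin2_cos2 (k * l j)). rewrite Hsj, Hc in H. unfold Rsqr in H. lra.
  - intros i Hi Hij. assert (Hsi := Hinc j i k Hj Hi ltac:(auto) Hk Hsj).
    destruct (Rmult_integral _ _ (Hzero i Hi)) as [-> |]; [ring|easy].
Qed.

Lemma spectral_sequence_eigenfun : incommensurable s l ->
  spectral_sequence s l (fun n => (spec_freq n)^2) eigenfun.
Proof.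
  intros Hinc. split; [apply eigenfun_is_eigenfunction|]. split; [|split].
  - intros n. assert (H1 := spec_freq_pos n). assert (H2 := spec_freq_lt n (S n) (le_n _)).
    apply pow_incr. lra.
  - apply eigenfun_orthogonal.
  - intros mu g Hg.
    assert (Hg0 := zero_generic_of_incommensurable Hinc mu g Hg).
    destruct (eigenfunction_form mu g Hg) as [k [B [Hk [Hmu [Hform Hkir]]]]].
    destruct Hg as [_ [_ [Hcont _]]].
    assert (HB : forall j, (j <= s)%nat -> B j * sin (k * l j) = g 0%nat 0).
    { intros j Hj. rewrite (Hcont 0%nat j (Nat.le_0_l _) Hj), Hform by easy.
      now rewrite Rminus_0_r. }
    assert (Hs : forall j, (j <= s)%nat -> sin (k * l j) <> 0).
    { intros j Hj H0. apply Hg0. rewrite <- (HB j Hj), H0. ring. }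
    assert (HB' : forall j, (j <= s)%nat -> B j = g 0%nat 0 / sin (k * l j)).
    { intros j Hj. rewrite <- (HB j Hj). field. now apply Hs. }
    assert (Hcot : cot_sum s l k = 0).
    { apply Rmult_eq_reg_l with (g 0%nat 0); [|easy].
      rewrite Rmult_0_r. etransitivity; [|exact Hkir].
      unfold cot_sum. rewrite scal_sum. apply sum_eq.
      intros j Hj. rewrite HB' by easy. unfold Rdiv. ring. }
    destruct (spec_freq_surj k Hk Hs Hcot) as [n Hn].
    (* Eigenvalues are simple: the central value determines the eigenfunction, and [eigenfun n] has
       central value 1. *)
    exists n, (fun i => if Nat.eqb i n then g 0%nat 0 else 0). split.
    + intros i Hi. destruct (Nat.eqb_spec i n) as [->|]; [|easy].
      exfalso. apply Hi. now rewrite Hmu, Hn.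
    + intros j x Hj _. rewrite (sum_f_R0_single _ n n (le_n _)).
      * rewrite Nat.eqb_refl, Hform, HB' by easy. unfold eigenfun. rewrite <- Hn.
        unfold Rdiv. ring.
      * intros i _ Hi. apply Nat.eqb_neq in Hi. rewrite Hi. ring.
Qed.

(** * Counting zeros *)

Lemma edge_zeros_union (g : graph_fun) (N t : nat) :
  (forall j, (1 <= j <= t)%nat -> exists Z : list R, NoDup Z /\ length Z = N /\
     forall x, In x Z <-> 0 < x < l j /\ g j x = 0) ->
  exists P : list (option (nat * R)), NoDup P /\ length P = (t * N)%nat /\
    forall p, In p P <-> exists j x, p = Some (j, x) /\ (1 <= j <= t)%nat /\
      0 < x < l j /\ g j x = 0.
Proof.
  induction t as [|t IH]; intros H.
  - exists nil. split; [constructor|]. split; [easy|]. intros p. split; [easy|].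
    intros [j [x [_ [Hj _]]]]. lia.
  - destruct IH as [P [HP1 [HP2 HP3]]]; [intros; apply H; lia|].
    destruct (H (S t)) as [Z [HZ1 [HZ2 HZ3]]]; [lia|].
    exists (map (fun x => Some (S t, x)) Z ++ P). split; [|split].
    + apply NoDup_app; [| easy |].
      * apply FinFun.Injective_map_NoDup; [|easy]. intros x y Hxy. congruence.
      * intros p Hp Hp'. apply in_map_iff in Hp. destruct Hp as [x [<- _]].
        apply HP3 in Hp'. destruct Hp' as [j [y [He [Hj _]]]]. injection He. lia.
    + rewrite length_app, length_map. simpl. lia.
    + intros p. rewrite in_app_iff, in_map_iff, HP3. split.
      * intros [[x [<- Hx]]|[j [x [-> [Hj Hx]]]]].
        -- apply HZ3 in Hx. exists (S t), x. split; [easy|]. split; [lia|easy].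
        -- exists j, x. split; [easy|]. split; [lia|easy].
      * intros [j [x [-> [Hj Hx]]]]. destruct (Nat.eq_dec j (S t)) as [->|].
        -- left. exists x. split; [easy|]. now apply HZ3.
        -- right. exists j, x. split; [easy|]. split; [lia|easy].
Qed.

(** On a short edge the sign chain gives [N] zeros; one more would make all coefficients vanish by
    [sine_comb_zeros], against the strict signs. *)
Lemma many_zeros_exact (M N : nat) : admissible s M l -> (N < M)%nat -> many_zeros s l N ->
  exists c : nat -> R, has_exactly_zeroes s l
    (fun j x => sum_f_R0 (fun n => c n * eigenfun n j x) N) (s * N).
Proof.
  intros Ha HN [c [Hlong Hshort]]. exists c.
  assert (Heq : forall j x, sum_f_R0 (fun n => c n * eigenfun n j x) N =
    sine_comb (fun n => c n / sin (freq s l n * l j)) (freq s l) N (l j - x)).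
  { intros j x. apply sum_eq. intros n Hn. unfold eigenfun.
    rewrite (spec_freq_eq_freq M n Ha) by lia. unfold Rdiv. ring. }
  assert (HPI := PI_RGT_0).
  destruct (edge_zeros_union (fun j x => sum_f_R0 (fun n => c n * eigenfun n j x) N) N s)
    as [P [HP1 [HP2 HP3]]].
  { intros j Hj. destruct (Hshort j Hj) as [sg Hch].
    set (a := fun n => c n / sin (freq s l n * l j)) in *.
    destruct (proj2 Ha j Hj) as [Hlj HljM].
    destruct (zero_chain_exhausts (sine_comb a (freq s l) N) (l j) N 0) as [Z [HZ1 [HZ2 HZ3]]].
    - apply zero_chain_of_signs with sg; [|easy]. intros; apply continuity_sine_comb.
    - intros Hz. assert (Ha0 : forall n, (n <= N)%nat -> a n = 0).
      { revert Hz. apply sine_comb_zeros.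
        - intros n Hn. split; [apply freq_pos with M; [easy|lia]|].
          assert (H := freq_lt_PI_mul s M l n (l j) Ha ltac:(lia) Hlj). nra.
        - intros; apply freq_increasing with M; [easy|easy|lia]. }
      destruct Hch as [y [_ [Hy _]]]. unfold sine_comb in Hy.
      rewrite sum_f_R0_zero in Hy; [lra|]. intros n Hn. rewrite Ha0 by easy. ring.
    - exists (map (fun y => l j - y) Z). split; [|split].
      + apply FinFun.Injective_map_NoDup; [|easy]. intros x y Hxy. lra.
      + now rewrite length_map.
      + intros x. rewrite in_map_iff, Heq. fold a. split.
        * intros [y [<- Hy]]. apply HZ3 in Hy.
          replace (l j - (l j - y)) with y by ring. split; [lra|easy].
        * intros [Hx Hx0]. exists (l j - x). split; [ring|]. apply HZ3. split; [lra|easy]. }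
  exists P. split; [easy|]. split; [easy|]. intros p. rewrite HP3.
  assert (Hl0 := proj1 Ha).
  (* Including [x = 0] also excludes the central vertex. *)
  assert (Hno : forall x, 0 <= x < 1 -> sum_f_R0 (fun n => c n * eigenfun n 0%nat x) N <> 0).
  { intros x Hx. rewrite Heq. apply Rgt_not_eq, Hlong. lra. }
  destruct p as [[j x]|]; simpl.
  - split.
    + intros [j' [x' [He [Hj Hx]]]]. injection He as -> ->. split; [lia|easy].
    + intros [Hj [Hx H0]]. exists j, x. split; [easy|]. split; [|easy].
      destruct j as [|j]; [|lia]. exfalso. apply (Hno x); [lra|easy].
  - split.
    + intros [j [x [He _]]]. easy.
    + intros H0. exfalso. apply (Hno 0); [lra|easy].
Qed.

End Poles.

Theorem theorem2 (s M : nat) (hs : (0 < s)%nat) (hM : (0 < M)%nat) :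
  exists len : nat -> R,
    (forall j, (j <= s)%nat -> 0 < len j) /\
    zero_generic s len /\
    exists (lam : nat -> R) (phi : nat -> graph_fun),
      spectral_sequence s len lam phi /\
      forall L : nat, (1 <= L)%nat -> (L <= M)%nat ->
        exists c : nat -> R,
          has_exactly_zeroes s len
            (fun j x => sum_f_R0 (fun n => c n * phi n j x) (L - 1))
            ((L - 1) + (L - 1) * (s - 1))%nat.
Proof.
  destruct (many_zeros_lengths_exist s M hs hM) as [l [Ha [Hinc Hmany]]].
  assert (Hl : forall j, (j <= s)%nat -> 0 < l j)
    by (intros; now apply admissible_pos with s M).
  exists l. split; [easy|]. split; [now apply zero_generic_of_incommensurable|].
  exists (fun n => (spec_freq s l n)^2), (eigenfun s l).
  split; [now apply spectral_sequence_eigenfun|].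
  intros L HL1 HLM.
  replace ((L - 1) + (L - 1) * (s - 1))%nat with (s * (L - 1))%nat by nia.
  apply many_zeros_exact with M; [easy|lia|apply Hmany; lia].
Qed.
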